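(* Let $d\geq 1$, $n\geq d+1$ and $k$ be integers with $0\leq k<\left\lfloor\frac{n}{d+1}\right\rfloor$. Then every set $S$ of $n$ points in general position in $\mathbb{R}^d$ satisfies $$E_k(S)\geq (d+1)\binom{k+d}{d}.$$ Furthermore, this bound is tight in the given range of $k$: there exists a set $S$ of $n$ points in general position in $\mathbb{R}^d$ with $E_k(S)=(d+1)\binom{k+d}{d}$.
   Context: A finite set $S\subset\mathbb{R}^d$ is in general position if every subset of at most $d+1$ of its points is affinely independent. A $j$-facet of $S$ is an oriented $(d-1)$-simplex with vertices in $S$, i.e. a $d$-element subset $\sigma\subset S$ together with a choice of one of the two open half-spaces bounded by the hyperplane spanned by $\sigma$ (called its positive side), such that the positive side contains exactly $j$ points of $S$. The number of $j$-facets of $S$ is denoted $e_j(S)$, and $E_k(S)=\sum_{j=0}^{k}e_j(S)$ is the number of $(\leq k)$-facets of $S$. *)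

(* Defs.v *)
From HB Require Import structures.
From mathcomp Require Import all_boot all_order all_algebra.
From mathcomp Require Import finmap.
From mathcomp Require Import mathcomp_extra boolp classical_sets functions.
From mathcomp Require Import cardinality reals.
From mathcomp Require Import ring lra.

Set Implicit Arguments.
Unset Strict Implicit.
Unset Printing Implicit Defensive.

Import Order.TTheory GRing.Theory Num.Theory.

Local Open Scope classical_set_scope.
Local Open Scope ring_scope.

Section Facets.
Variables (R : realType) (d : nat).
Notation point := 'rV[R]_d.
Implicit Types (S sigma T : {fset point}) (H h : set point).

Definition affinely_independent T : Prop :=
  forall c : point -> R,
    \sum_(x <- T) c x = 0 -> \sum_(x <- T) c x *: x = 0 ->
    forall x, x \in T -> c x = 0.

Definition general_position S : Prop :=
  forall T, (T `<=` S)%fset -> (#|` T| <= d.+1)%N -> affinely_independent T.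

Definition affine_span T : set point :=
  [set y | exists c : point -> R,
     \sum_(x <- T) c x = 1 /\ y = \sum_(x <- T) c x *: x].

Definition dotprod (a x : point) : R := \sum_(i < d) a 0 i * x 0 i.

(* Forces [h] to be a hyperplane; replacing (a, b) by (- a, - b) gives the
   half-space on the other side. *)
Definition open_halfspace_bounded_by h H : Prop :=
  exists a b, [/\ a != 0,
    h = [set x | dotprod a x = b] & H = [set x | b < dotprod a x]].

(* An oriented simplex is a pair: vertex set, positive side. *)
Definition jfacet S (j : nat) : set ({fset point} * set point) :=
  [set f | [/\ (f.1 `<=` S)%fset, #|` f.1| = d,
     open_halfspace_bounded_by (affine_span f.1) f.2 &
     #|` [fset x in S | x \in f.2]%fset| = j]].

(* [fset_set] returns fset0 on infinite sets; [finite_jfacet] below rules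
   this case out. *)
Definition num_jfacets S j : nat := #|` fset_set (jfacet S j)|.

Definition num_lekfacets S k : nat := (\sum_(j < k.+1) num_jfacets S j)%N.

Lemma dotprodD a t x y :
  dotprod a (t *: x + (1 - t) *: y) = t * dotprod a x + (1 - t) * dotprod a y.
Proof.
rewrite /dotprod !mulr_sumr -big_split /=; apply: eq_bigr => i _.
by rewrite !mxE; ring.
Qed.

Lemma open_halfspace_sub h H H' q :
  open_halfspace_bounded_by h H -> open_halfspace_bounded_by h H' ->
  H q -> H' q -> (H `<=` H')%classic.
Proof.
move=> [a [b [_ hE ->]]] [a' [b' [_ hE' ->]]] /= aq aq' x /= ax.
have [//|xb'|xb'] := ltgtP b' (dotprod a' x); last first.
  have : h x by rewrite hE'.
  by rewrite hE /= => xb; rewrite xb ltxx in ax.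
pose D := dotprod a' q - dotprod a' x.
have D0 : 0 < D by rewrite /D; lra.
pose t := (dotprod a' q - b') / D.
have tD : t * D = dotprod a' q - b' by rewrite /t mulfVK// gt_eqF.
have t0 : 0 < t by rewrite /t divr_gt0//; lra.
have t1 : t < 1 by rewrite /t ltr_pdivrMr// mul1r /D; lra.
have : h (t *: x + (1 - t) *: q).
  by rewrite hE' /= dotprodD; move: tD; rewrite /D; lra.
rewrite hE /= dotprodD => hb.
suff : b < t * dotprod a x + (1 - t) * dotprod a q by rewrite hb ltxx.
have : 0 < t * (dotprod a x - b) by rewrite mulr_gt0//; lra.
have : 0 < (1 - t) * (dotprod a q - b) by rewrite mulr_gt0//; lra.
lra.
Qed.

Lemma open_halfspace_neq0 h H : open_halfspace_bounded_by h H -> H !=set0.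
Proof.
move=> [a [b [a0 _ ->]]].
have aa0 i : 0 <= a 0 i * a 0 i by rewrite -expr2 sqr_ge0.
have aa : 0 < dotprod a a.
  rewrite lt_def sumr_ge0// andbT; apply: contra a0 => /eqP aa.
  apply/eqP/rowP => i; rewrite mxE.
  have /eqP := psumr_eq0P (fun i _ => aa0 i) aa (i := i) isT.
  by rewrite mulf_eq0 orbb => /eqP.
exists (((b + 1) / dotprod a a) *: a) => /=.
rewrite (_ : dotprod a _ = b + 1) ?ltrDl//.
rewrite -[RHS](mulfVK (lt0r_neq0 aa)) /dotprod mulr_sumr.
by apply: eq_bigr => i _; rewrite mxE mulrCA.
Qed.

Lemma finite_open_halfspaces h : finite_set [set H | open_halfspace_bounded_by h H].
Proof.
have [[H0 hH0]|noH] := pselect (exists H0, open_halfspace_bounded_by h H0); last first.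
  rewrite (_ : [set H | _] = set0) //.
  by apply/seteqP; split => // H /= hH; apply: noH; exists H.
have [a [b [a0 hE H0E]]] := hH0.
pose H1 := [set x | - b < dotprod (- a) x].
have dotN x : dotprod (- a) x = - dotprod a x.
  by rewrite /dotprod -sumrN; apply: eq_bigr => i _; rewrite mxE mulNr.
have hH1 : open_halfspace_bounded_by h H1.
  exists (- a), (- b); split => //; first by rewrite oppr_eq0.
  rewrite hE; apply/seteqP; split => x /=; rewrite dotN; first by move=> ->.
  exact: oppr_inj.
apply: (@sub_finite_set _ _ [set H0; H1]); last by rewrite finite_setU; split; exact: finite_set1.
move=> H /= hH; have [q Hq] := open_halfspace_neq0 hH.
have eqH K : open_halfspace_bounded_by h K -> K q -> H = K.
  move=> hK Kq; apply/seteqP; split; [exact: (open_halfspace_sub hH hK Hq Kq)|].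
  exact: (open_halfspace_sub hK hH Kq Hq).
have [qb|bq|qb] := ltgtP (dotprod a q) b.
- by right; apply: eqH => //; rewrite /H1 /= dotN ltrN2.
- by left; apply: eqH => //; rewrite H0E.
- have : h q by rewrite hE.
  have [a' [b' [_ -> HE]]] := hH.
  by move: Hq; rewrite HE /= => /[swap] ->; rewrite ltxx.
Qed.

Lemma finite_jfacet S j : finite_set (jfacet S j).
Proof.
apply: (@sub_finite_set _ _ ([set` fpowerset S] `*``
  (fun sigma => [set H | open_halfspace_bounded_by (affine_span sigma) H]))).
  by move=> f [/= fS _ hf _]; split => //=; rewrite fpowersetE.
by apply: finite_setXR => [|sigma _]; [exact: finite_fset|exact: finite_open_halfspaces].
Qed.

End Facets.

(* Main.v *)
(** Idea of the lower bound.  By Helly's theorem there is a point O such that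
    every open half-space with O on its boundary contains more than k points
    of S; perturb O into general position.  Under the polarity centred at O the
    (<= k)-facets having O on their negative side are the vertices of level at
    most k in the arrangement of the hyperplanes a_q . x = 1, a_q = q - O, where
    the level of x is the number of q with a_q . x > 1.  The number V_d(k) of
    these vertices is bounded below by induction on d and k: if p spans a facet
    of the cell of level 0, then

      V_d(k) >= V_d(k-1) for the arrangement without p
              + V_{d-1}(k) for the arrangement induced on the hyperplane of p
              + the number of vertices of level exactly k at which the linear
                form - a_p is maximal over the d hyperplanes involved,

    and these three families are disjoint.  The last number is C(k+d-1, d-1):
    for every set M of at most k hyperplanes there is exactly one such vertex
    that is the maximum of - a_p over the polyhedron left after deleting M, and
    double counting gives a triangular linear system.

    The bound is attained by points placed along the d+1 rays from the origin
    through the vertices of a simplex, slightly perturbed: a (<= k)-facet has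
    at most one vertex near each ray, and if it uses the point of rank r on a
    ray, then the r points further out lie on its positive side. *)

Require Import Defs.
From HB Require Import structures.
From mathcomp Require Import all_boot all_order all_algebra.
From mathcomp Require Import finmap.
From mathcomp Require Import mathcomp_extra boolp classical_sets functions.
From mathcomp Require Import cardinality reals.
From mathcomp Require Import zify ring lra.

Set Implicit Arguments.
Unset Strict Implicit.
Unset Printing Implicit Defensive.

Import Order.TTheory GRing.Theory Num.Theory.

(** * Counting lemmas *)

Section Binomials.
Import fintype mathcomp.boot.finset.
Local Open Scope nat_scope.

Lemma hockey_stick d m : \sum_(j < m.+1) 'C(j + d, d) = 'C(m + d.+1, m).
Proof.
elim: m => [|m IH]; first by rewrite big_ord1 add0n binn bin0.
rewrite big_ord_recr IH /= [in RHS]addSn binS addnC; congr (_ + _).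
by rewrite -addSnnS -[in RHS]bin_sub ?leq_addr// addKn.
Qed.

(** The coefficient of [x^m] in [(1-x)^-(d+1) (1-x)^-(N+1) = (1-x)^-(N+d+2)]. *)
Lemma sum_bin_mul_bin d N m :
  \sum_(j < m.+1) 'C(j + d, d) * 'C(N + (m - j), m - j) = 'C(N + m + d.+1, m).
Proof.
have binC a b : 'C(a + b, b) = 'C(a + b, a).
  by rewrite -[LHS]bin_sub ?leq_addl// addnK.
under eq_bigr => j _ do rewrite (binC N).
elim: N m => [|N IHN] m.
  under eq_bigr => j _ do rewrite bin0 muln1.
  by rewrite add0n hockey_stick.
elim: m => [|m IHm].
  by rewrite big_ord1 add0n subn0 addn0 !binn bin0.
have -> : N.+1 + m.+1 + d.+1 = (N + m.+1 + d.+1).+1 by lia.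
rewrite binS -IHN (_ : N + m.+1 + d.+1 = N.+1 + m + d.+1) -?IHm; last by lia.
rewrite big_ord_recr [X in _ = X + _]big_ord_recr /= subnn !addn0 !binn.
rewrite [RHS]addnAC; congr (_ + _).
rewrite -big_split; apply: eq_bigr => j _ /=.
have jm : j <= m by rewrite -ltnS.
rewrite -mulnDr subSn//; congr (_ * _).
by rewrite [in LHS]addnS binS addnC addSnnS.
Qed.

Lemma card_sets_between (T : finType) (V W : {set T}) m :
  V \subset W -> #|V| <= m ->
  #|[set M : {set T} | [&& V \subset M, M \subset W & #|M| == m]]| =
  'C(#|W| - #|V|, m - #|V|).
Proof.
move=> VW Vm.
rewrite -(cardsDS VW) -cards_draws -[RHS](@card_in_imset _ _ (fun A => V :|: A)); last first.
  move=> A B; rewrite !inE. rewrite !subsetD => /andP[/andP[_ dA] _] /andP[/andP[_ dB] _] /= e.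
  have aux (C : {set T}) : [disjoint C & V] -> C = (V :|: C) :\: V.
    by move=> /disjoint_setI0 CV; rewrite setDUl setDv set0U; apply/esym/setDidPl; rewrite -setI_eq0 CV.
  by rewrite (aux _ dA) (aux _ dB) e.
congr #|pred_of_set _|; apply/setP => M; rewrite !inE; apply/idP/imsetP.
- move=> /and3P[VM MW /eqP Mm]; exists (M :\: V).
    by rewrite inE setSD//= cardsDS// Mm.
  by rewrite setUC setDE setUIl (setUC (~: V)) setUCr setIT; apply/esym/setUidPl.
- move=> [A]; rewrite inE subsetD => /andP[/andP[AW dA] /eqP cA] ->.
  rewrite subsetUl subUset VW AW/= cardsU setIC (disjoint_setI0 dA) cards0 subn0.
  by rewrite cA subnKC.
Qed.

(* Each [M] of size [m] has one [B] with [V B \subset M \subset I :\: B], so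
   ['C(n, m)] is a triangular linear combination of the counts to be found. *)
Lemma card_basis_viol d (T : finType) (I : {set T}) (F : {set {set T}})
    (V : {set T} -> {set T}) k :
  (forall B, B \in F ->
     [/\ B \subset I, #|B| = d.+1, V B \subset I & [disjoint B & V B]]) ->
  (forall M : {set T}, M \subset I -> #|M| <= k ->
     #|[set B in F | [disjoint B & M] && (V B \subset M)]| = 1) ->
  k <= #|I| ->
  #|[set B in F | #|V B| == k]| = 'C(k + d, d).
Proof.
move=> HF; elim/ltn_ind: k => k IH HM kI.
(* Some basis is disjoint from a given [M] of size [k], so both fit in [I]; the natural subtractions
   below are then exact. *)
have sizeI : k + d.+1 <= #|I|.
  have [M] : exists M : {set T}, M \in [set A : {set T} | A \subset I & #|A| == k].
    by apply/set0Pn; rewrite -card_gt0 cards_draws bin_gt0.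
  rewrite inE => /andP[MI /eqP Mk].
  have := HM M MI; rewrite Mk leqnn => /(_ isT) e1.
  have /card_gt0P[B] : 0 < #|[set B in F | [disjoint B & M] && (V B \subset M)]| by rewrite e1.
  rewrite inE => /and3P[BF dBM _]; have [BI <- _ _] := HF B BF.
  have MB : #|M :|: B| = #|M| + #|B|.
    by rewrite cardsU setIC disjoint_setI0// cards0 subn0.
  by rewrite -Mk -MB subset_leq_card// subUset MI.
set h := fun j => #|[set B in F | #|V B| == j]|.
have E m : m <= k -> 'C(#|I|, m) = \sum_(j < m.+1) h j * 'C(#|I| - d.+1 - j, m - j).
  move=> mk; rewrite -cards_draws -sum1_card.
  transitivity (\sum_(M in [set A : {set T} | A \subset I & #|A| == m])
     \sum_(B in F | [disjoint B & M] && (V B \subset M)) 1).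
    apply: eq_bigr => M; rewrite inE => /andP[MI /eqP Mm].
    rewrite -[LHS](HM M MI) ?Mm// -sum1_card; apply: eq_bigl => B.
    by rewrite inE.
  rewrite (exchange_big_dep (fun B => (B \in F) && (#|V B| <= m))) /=; last first.
    move=> M B; rewrite inE => /andP[_ /eqP <-] /and3P[-> _ VM].
    by rewrite subset_leq_card.
  rewrite (partition_big (fun B => inord #|V B| : 'I_m.+1) xpredT)//=.
  apply: eq_bigr => j _; rewrite /h -sum1_card big_distrl /=.
  have ej B : #|V B| <= m -> (inord #|V B| == j) = (#|V B| == j).
    by move=> Vm; rewrite -val_eqE /= inordK.
  rewrite (eq_bigl (fun B => B \in [set B in F | #|V B| == j])); last first.
    move=> B; rewrite !inE; case: (B \in F) => //=.
    have [Vm|] := leqP #|V B| m; first by rewrite /= ej.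
    by move=> mV; apply/esym/negbTE; rewrite gtn_eqF//; apply: leq_trans mV; rewrite ltn_ord.
  apply: eq_bigr => B; rewrite inE => /andP[BF /eqP Vj].
  have [BI Bd VI dBV] := HF B BF.
  rewrite mul1n sum1_card -Bd -(cardsDS BI) -Vj -card_sets_between; last 2 first.
  - by rewrite subsetD VI disjoint_sym.
  - by rewrite Vj -ltnS ltn_ord.
  apply: eq_card => M; rewrite [LHS]inE BF/= !inE (disjoint_sym B) subsetD.
  by case: (M \subset I); case: (V B \subset M); case: (#|M| == m); case: [disjoint _ & _].
(* The term [j = k] has coefficient 1, so the smaller [h j] determine [h k]; by [sum_bin_mul_bin]
   the expected binomials solve the same equation. *)
have /esym := E k (leqnn k); rewrite big_ord_recr /= subnn bin0 muln1.
rewrite (eq_bigr (fun j : 'I_k => 'C(j + d, d) * 'C(#|I| - d.+1 - j, k - j))); last first.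
  move=> j _; congr (_ * _); apply: IH => //.
    by move=> M MI Mj; apply: HM => //; apply: leq_trans Mj _; apply: ltnW.
  by apply: leq_trans kI; apply: ltnW.
have -> : #|I| = (#|I| - d.+1 - k) + k + d.+1 by lia.
rewrite -sum_bin_mul_bin big_ord_recr /= subnn bin0 muln1.
rewrite (eq_bigr (fun j : 'I_k => 'C(j + d, d) * 'C(#|I| - d.+1 - k + (k - j), k - j))).
  by move=> /eqP; rewrite eqn_add2l => /eqP.
by move=> j _; congr (_ * 'C(_, _)); have := ltn_ord j; lia.
Qed.

End Binomials.

(** * Arrangements of hyperplanes *)

Section DotProduct.
Local Open Scope ring_scope.
Variables (R : realType) (d : nat).
Implicit Types (a x y u : 'rV[R]_d) (c : R).

Lemma dotprodE a x : dotprod a x = (a *m x^T) 0 0.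
Proof. by rewrite !mxE; apply: eq_bigr => i _; rewrite mxE. Qed.

Lemma dotprodC a x : dotprod a x = dotprod x a.
Proof. by apply: eq_bigr => i _; rewrite mulrC. Qed.

Lemma dotprodDr a x y : dotprod a (x + y) = dotprod a x + dotprod a y.
Proof. by rewrite !dotprodE linearD mulmxDr mxE. Qed.

Lemma dotprodZr a c x : dotprod a (c *: x) = c * dotprod a x.
Proof. by rewrite !dotprodE linearZ -scalemxAr mxE. Qed.

Lemma dotprodNr a x : dotprod a (- x) = - dotprod a x.
Proof. by rewrite -scaleN1r dotprodZr mulN1r. Qed.

Lemma dotprodBr a x y : dotprod a (x - y) = dotprod a x - dotprod a y.
Proof. by rewrite dotprodDr dotprodNr. Qed.

Lemma dotprod0r a : dotprod a 0 = 0.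
Proof. by rewrite -(scale0r 0) dotprodZr mul0r. Qed.

Lemma dotprod_sumr a (I : Type) (r : seq I) (P : pred I) (F : I -> 'rV[R]_d) :
  dotprod a (\sum_(i <- r | P i) F i) = \sum_(i <- r | P i) dotprod a (F i).
Proof. exact: (big_morph _ (dotprodDr a) (dotprod0r a)). Qed.

Lemma dotprodDl a x y : dotprod (x + y) a = dotprod x a + dotprod y a.
Proof. by rewrite !(dotprodC _ a) dotprodDr. Qed.

Lemma dotprodZl a c x : dotprod (c *: x) a = c * dotprod x a.
Proof. by rewrite !(dotprodC _ a) dotprodZr. Qed.

Lemma dotprodNl a x : dotprod (- x) a = - dotprod x a.
Proof. by rewrite !(dotprodC _ a) dotprodNr. Qed.

Lemma dotprod0l a : dotprod 0 a = 0.
Proof. by rewrite dotprodC dotprod0r. Qed.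

Lemma dotprod_suml a (I : Type) (r : seq I) (P : pred I) (F : I -> 'rV[R]_d) :
  dotprod (\sum_(i <- r | P i) F i) a = \sum_(i <- r | P i) dotprod (F i) a.
Proof. exact: (big_morph (fun x => dotprod x a) (dotprodDl a) (dotprod0l a)). Qed.

End DotProduct.

Section Basis.
Local Open Scope ring_scope.
Variables (R : realType) (d : nat) (T : finType) (a : T -> 'rV[R]_d) (B : {set T}).
Hypothesis cardB : #|B| = d.
Hypothesis sepB : forall u, (forall q, q \in B -> dotprod (a q) u = 0) -> u = 0.

Let A : 'M_(#|B|, d) := \matrix_(i < #|B|) a (enum_val i).

Let mulA u i : (u *m A^T) 0 i = dotprod (a (enum_val i)) u.
Proof. by rewrite !mxE; apply: eq_bigr => j _; rewrite !mxE mulrC. Qed.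

Let rankA : \rank A^T = d.
Proof.
apply/eqP; rewrite -/(row_free A^T) -kermx_eq0; apply/rowV0P => u /sub_kermxP uA.
apply: sepB => q qB; rewrite -(enum_rankK_in qB qB) -mulA uA.
by rewrite mxE.
Qed.

Lemma basis_solve (v : T -> R) : exists x, forall q, q \in B -> dotprod (a q) x = v q.
Proof.
have full : row_full A^T by rewrite /row_full rankA cardB.
have /submxP[x xE] := submx_full (\row_i v (enum_val i)) full.
exists x => q qB; rewrite -(enum_rankK_in qB qB) -mulA -xE.
by rewrite mxE.
Qed.

Lemma basis_span (c : 'rV[R]_d) : exists l : T -> R, c = \sum_(q in B) l q *: a q.
Proof.
have full : row_full A by rewrite /row_full -mxrank_tr rankA.
have /submxP[D ->] := submx_full c full.
exists (fun q => \sum_i D 0 i *+ (enum_val i == q)).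
rewrite mulmx_sum_row [RHS]big_enum_val /=; apply: eq_bigr => i _.
rewrite rowK (bigD1 i)//= eqxx mulr1n big1 ?addr0// => j ji.
by rewrite (inj_eq enum_val_inj) (negbTE ji).
Qed.

End Basis.

Section Arrangement.
Import fintype mathcomp.boot.finset.
Local Open Scope ring_scope.
Variables (R : realType) (T : finType).

Section FixedDimension.
Variable d : nat.
Implicit Types (a : T -> 'rV[R]_d) (b : T -> R) (I B Q M : {set T}) (x u : 'rV[R]_d).

Definition tight a b I x := [set q in I | dotprod (a q) x == b q].

Definition above a b I x := [set q in I | b q < dotprod (a q) x].

(* With [b = 0], the first clause says that any [d] of the normals [a q] are
   linearly independent. *)
Definition simple_arrangement a b I :=
  (forall u, u != 0 -> (#|tight a (fun=> 0%R) I u| < d)%N) /\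
  (forall x, (#|tight a b I x| <= d)%N).

(** Already for [k = 0] this forces every ray to leave the polyhedron [a q . x <= b q], which is
    therefore bounded. *)
Definition deep a I k := forall u, u != 0 -> (k < #|above a (fun=> 0%R) I u|)%N.

(** Recording a vertex by the [d] hyperplanes meeting there allows counting in a finite type; in a
    simple arrangement the set determines the point. *)
Definition lek_vertices a b I k :=
  [set B : {set T} | [&& B \subset I, #|B| == d &
    `[< exists2 x, (forall q, q \in B -> dotprod (a q) x = b q) &
                   (#|above a b I x| <= k)%N >]]].

Lemma simple_arrangementS a b I Q :
  Q \subset I -> simple_arrangement a b I -> simple_arrangement a b Q.
Proof.
move=> /subsetP QI [s1 s2]; split=> [u /s1|x]; [apply: leq_ltn_trans|apply: leq_trans (s2 x)];
  by apply: subset_leq_card; apply/subsetP => q; rewrite !inE => /andP[/QI -> ->].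
Qed.

Lemma deep_setD a I M k m : (#|M| <= m)%N -> deep a I (m + k) -> deep a (I :\: M) k.
Proof.
move=> Mm dI u /dI; set A := above _ _ _ _ => kA.
have -> : above a (fun=> 0) (I :\: M) u = A :\: M.
  by apply/setP => q; rewrite !inE andbA.
have := cardsID M A; have := subset_leq_card (subsetIr A M); lia.
Qed.

Lemma simple_sep a b I B : simple_arrangement a b I -> B \subset I -> #|B| = d ->
  forall u, (forall q, q \in B -> dotprod (a q) u = 0) -> u = 0.
Proof.
move=> [s1 _] /subsetP BI cB u uB; apply/eqP; apply/negPn/negP => /s1.
rewrite ltnNge -{1}cB; apply/negP/negPn; apply/subset_leq_card/subsetP => q qB.
by rewrite !inE BI// uB/=.
Qed.

Lemma vertex_uniq a b I B x y : simple_arrangement a b I -> B \subset I -> #|B| = d ->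
  (forall q, q \in B -> dotprod (a q) x = b q) ->
  (forall q, q \in B -> dotprod (a q) y = b q) -> x = y.
Proof.
move=> s BI cB xB yB; apply/eqP; rewrite -subr_eq0; apply/eqP.
by apply: (simple_sep s BI cB) => q qB; rewrite dotprodBr xB// yB// subrr.
Qed.

(** * Linear programming on a bounded polyhedron *)

Section LinearProgram.
Variables (a : T -> 'rV[R]_d) (b : T -> R) (I Q : {set T}) (p : T).
Hypotheses (simpleI : simple_arrangement a b I) (QI : Q \subset I) (pI : p \in I).
Hypothesis deepQ : deep a Q 0.

Let feasible x := forall q, q \in Q -> dotprod (a q) x <= b q.

(** The ratio test of the simplex method: depth makes some hyperplane of [Q] block the ray, and the
    first one met is selected. *)
Lemma advance x u : feasible x -> u != 0 ->
  (forall q, q \in tight a b Q x -> dotprod (a q) u <= 0) ->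
  exists2 t, 0 < t & feasible (x + t *: u) /\
    exists2 q, q \in Q & 0 < dotprod (a q) u /\ dotprod (a q) (x + t *: u) = b q.
Proof.
move=> xQ u0 tu.
have /card_gt0P[q0] := deepQ u0; rewrite inE => /= q0P.
pose P := [pred q in Q | 0 < dotprod (a q) u].
pose F q := (b q - dotprod (a q) x) / dotprod (a q) u.
have [q /andP[qQ qu] qmin] := @arg_minP _ _ _ q0 P F q0P.
exists (F q).
  apply: divr_gt0 => //; rewrite subr_gt0 lt_neqAle xQ// andbT; apply/negP => xq.
  have /tu : q \in tight a b Q x by rewrite inE qQ.
  by rewrite leNgt qu.
split; last first.
  by exists q => //; split=> //; rewrite dotprodDr dotprodZr mulfVK ?gt_eqF// addrC subrK.
move=> r rQ; rewrite dotprodDr dotprodZr -lerBrDl.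
have [ru|ru] := ltP 0 (dotprod (a r) u).
  by rewrite -ler_pdivlMr// qmin// inE rQ.
apply: (@le_trans _ _ 0); last by rewrite subr_ge0 xQ.
apply: mulr_ge0_le0 => //; apply: divr_ge0; last exact: ltW.
by rewrite subr_ge0 xQ.
Qed.

(** While fewer than [d] hyperplanes are tight, some [u != 0] is orthogonal to their normals;
    advancing along [u] keeps them tight and adds one. *)
Lemma exists_feasible_vertex x0 : feasible x0 ->
  exists2 x, feasible x & #|tight a b Q x| = d.
Proof.
move=> fx0.
suff H m : (m <= d)%N -> exists2 x, feasible x & (m <= #|tight a b Q x|)%N.
  have [x fx xd] := H d (leqnn d); exists x => //; apply/eqP; rewrite eqn_leq xd andbT.
  by have [_ ->] := simple_arrangementS QI simpleI.
elim: m => [|m IH] md; first by exists x0.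
have [x fx mx] := IH (ltnW md).
have [mx'|] := ltnP m #|tight a b Q x|; first by exists x.
move=> xm; have tm : #|tight a b Q x| = m by apply/eqP; rewrite eqn_leq xm.
pose A : 'M_(#|tight a b Q x|, d) := \matrix_i a (enum_val i).
have : kermx A^T != 0.
  rewrite kermx_eq0 /row_free neq_ltn; apply/orP; left.
  by rewrite mxrank_tr; apply: leq_ltn_trans (rank_leq_row _) _; rewrite tm.
move=> /rowV0Pn[u /sub_kermxP uA u0].
have uO q : q \in tight a b Q x -> dotprod (a q) u = 0.
  move=> qt; have := congr1 (fun w : 'rV_ _ => w 0 (enum_rank_in qt q)) uA.
  rewrite !mxE => <-; apply: eq_bigr => j _.
  by rewrite !mxE mulrC enum_rankK_in.
have [|t t0 [fy [q qQ [qu qb]]]] := advance fx u0.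
  by move=> q /uO ->.
exists (x + t *: u) => //.
have qt : q \notin tight a b Q x by apply/negP => /uO e; rewrite e ltxx in qu.
have <- : #|q |: tight a b Q x| = m.+1 by rewrite cardsU1 qt tm.
apply: subset_leq_card; apply/subsetP => r; rewrite !inE => /orP[/eqP ->|/andP[rQ rx]].
  by rewrite qQ qb/=.
by rewrite rQ dotprodDr dotprodZr uO ?inE ?rQ// mulr0 addr0.
Qed.

(* The objective [- a p] needs no genericity assumption: it lies on no proper
   face of a cone of normals, because [a p] is itself one of the normals. *)
Lemma lp_optimum x0 : feasible x0 ->
  exists x, exists l : T -> R, [/\ feasible x, #|tight a b Q x| = d,
    (forall q, q \in tight a b Q x -> 0 < l q) &
    - a p = \sum_(q in tight a b Q x) l q *: a q].
Proof.
move=> /exists_feasible_vertex[x1 fx1 cx1].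
pose V B := `[< exists x, feasible x /\ tight a b Q x = B >] && (#|B| == d).
pose xs B := xget 0 (fun x => feasible x /\ tight a b Q x = B).
have xsP B : V B -> feasible (xs B) /\ tight a b Q (xs B) = B.
  move=> /andP[/asboolP hB _]; exact: (xgetPex 0 hB).
have VP x : feasible x -> #|tight a b Q x| = d -> V (tight a b Q x).
  by move=> fx cx; rewrite /V cx eqxx andbT; apply/asboolP; exists x.
have tightQ x : tight a b Q x \subset Q by apply/subsetP => q; rewrite inE => /andP[].
have [B VB Bmax] := @arg_maxP _ _ _ (tight a b Q x1) V (fun B => dotprod (- a p) (xs B)) (VP _ fx1 cx1).
have [fx tB] := xsP _ VB; have /andP[_ /eqP cB] := VB.
set x := xs B in fx tB.
have BQ : B \subset Q by rewrite -tB tightQ.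
have BI := subset_trans BQ QI.
have sep := simple_sep simpleI BI cB.
(* Following [u] leaves only the hyperplane of [q] and reaches an adjacent vertex; if [- a p]
   increased on the way, that vertex would beat the maximum. *)
have edge q u : q \in B -> (forall r, r \in B -> dotprod (a r) u = - (r == q)%:R) ->
    0 <= dotprod (a p) u.
  move=> qB uB; rewrite leNgt; apply/negP => pu.
  have u0 : u != 0 by apply: contraTneq pu => ->; rewrite dotprod0r ltxx.
  have [|t t0 [fy [r rQ [ru rb]]]] := advance fx u0.
    by rewrite tB => r /uB ->; rewrite oppr_le0 ler0n.
  have rB : r \notin B by apply/negP => /uB e; rewrite e oppr_gt0 ltrn0 in ru.
  set y := x + t *: u in fy rb.
  have sub : r |: (B :\ q) \subset tight a b Q y.
    apply/subsetP => s; rewrite !inE => /orP[/eqP ->|/andP[sq sB]]; first by rewrite rQ rb/=.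
    rewrite (subsetP BQ)//= dotprodDr dotprodZr uB// (negbTE sq) oppr0 mulr0 addr0.
    by move: sB; rewrite -tB inE => /andP[].
  have cy : #|tight a b Q y| = d.
    apply/eqP; rewrite eqn_leq; have [_ -> /=] := simple_arrangementS QI simpleI.
    apply: leq_trans (subset_leq_card sub).
    by rewrite cardsU1 !inE (negbTE rB) andbF /= -cB [in X in (X <= _)%N](cardsD1 q) qB.
  have Vy := VP _ fy cy.
  have [fz tz] := xsP _ Vy.
  have ey : xs (tight a b Q y) = y.
    apply: (vertex_uniq simpleI (subset_trans (tightQ y) QI) cy) => s sy.
      by move: sy; rewrite -[in X in X -> _]tz inE => /andP[_ /eqP].
    by move: sy; rewrite inE => /andP[_ /eqP].
  have := Bmax _ Vy; rewrite /= ey /y dotprodDr dotprodZr leNgt => /negP; apply.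
  by rewrite ltrDl mulr_gt0// dotprodNl oppr_gt0.
have dual q : q \in B -> exists u, forall r, r \in B -> dotprod (a r) u = - (r == q)%:R.
  by move=> qB; have [u uB] := basis_solve cB sep (fun r => - (r == q)%:R); exists u.
have pB : p \notin B.
  apply/negP => pB; have [u uB] := dual p pB.
  by have := edge p u pB uB; rewrite uB// eqxx lerNr oppr0 lern0.
have [l lE] := basis_span sep (- a p).
exists x, l; rewrite tB; split => // q qB.
have [u uB] := dual q qB.
have lq : dotprod (a p) u = l q.
  apply: oppr_inj; rewrite -dotprodNl lE dotprod_suml (bigD1 q)//= big1 ?addr0.
    by rewrite dotprodZl uB// eqxx mulrN1.
  by move=> r /andP[rB rq]; rewrite dotprodZl uB// (negbTE rq) oppr0 mulr0.
(* If [l q] vanished, [u] would be orthogonal to the normals of [p] and of [B :\ q], [d] in all,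
   which simplicity forbids. *)
rewrite lt_def -lq (edge q u)// andbT; apply/negP => /eqP pu.
have u0 : u != 0.
  by apply/eqP => u0; have := uB q qB; rewrite u0 dotprod0r eqxx => /eqP; rewrite eq_sym oppr_eq0 oner_eq0.
have [s1 _] := simpleI; have := s1 u u0; rewrite ltnNge => /negP; apply.
have -> : d = #|p |: (B :\ q)|.
  by rewrite cardsU1 !inE (negbTE pB) andbF/= -cB [in LHS](cardsD1 q) qB.
apply: subset_leq_card; apply/subsetP => s; rewrite !inE => /orP[/eqP ->|/andP[sq sB]].
  by rewrite pI pu/=.
by rewrite (subsetP BI)// uB// (negbTE sq) oppr0/=.
Qed.

End LinearProgram.
End FixedDimension.
End Arrangement.

(** * Vertices of low level *)

Section VertexCount.
Import fintype mathcomp.boot.finset.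
Local Open Scope ring_scope.
Variables (R : realType) (T : finType).
Implicit Types (I B Q M : {set T}).

(** [F] collects the dual feasible bases for the objective [- a p], and [V B] the constraints that
    the vertex of [B] violates. For each [M] of size at most [k], the optimal basis over [I :\: M]
    is the only member of [F] avoiding [M] with [V B] inside [M], so [card_basis_viol] applies. *)
Lemma card_exact_level d (a : T -> 'rV[R]_d.+1) (b : T -> R) I p k x0 :
  simple_arrangement a b I -> p \in I -> deep a I k ->
  (forall q, q \in I -> dotprod (a q) x0 < b q) ->
  ('C(k + d, d) <= #|[set B : {set T} | [&& B \subset I, #|B| == d.+1 &
    `[< exists x, [/\ forall q, q \in B -> dotprod (a q) x = b q,
         #|above a b I x| = k & (dotprod (a p) x < b p)%R] >]]]|)%N.
Proof.
move=> sI pI dI x0I.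
pose F := [set B : {set T} | [&& B \subset I, #|B| == d.+1 &
  `[< exists l : T -> R, (forall q, q \in B -> 0 < l q) /\
        - a p = \sum_(q in B) l q *: a q >]]].
pose xv B := xget 0 (fun x => forall q, q \in B -> dotprod (a q) x = b q).
pose V B := above a b I (xv B).
have FP B : B \in F -> [/\ B \subset I, #|B| = d.+1,
    exists l : T -> R, (forall q, q \in B -> 0 < l q) /\ - a p = \sum_(q in B) l q *: a q &
    forall q, q \in B -> dotprod (a q) (xv B) = b q].
  rewrite inE => /and3P[BI /eqP cB /asboolP lB]; split=> //.
  exact: (xgetPex 0 (basis_solve cB (simple_sep sI BI cB) b)).
have kI : (k <= #|I|)%N.
  have u0 : (const_mx 1 : 'rV[R]_d.+1) != 0.
    by apply/eqP => /rowP/(_ 0); rewrite !mxE => /eqP; rewrite oner_eq0.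
  apply: leq_trans (ltnW (dI _ u0)) _; apply/subset_leq_card/subsetP => q.
  by rewrite inE => /andP[].
have aboveS x Q : Q \subset I -> (forall q, q \in Q -> dotprod (a q) x <= b q) <->
    above a b I x \subset I :\: Q.
  move=> /subsetP QI; split=> [xQ|/subsetP sub q qQ].
    apply/subsetP => q; rewrite !inE => /andP[-> qx]; rewrite andbT.
    by apply/negP => /xQ; rewrite leNgt qx.
  rewrite leNgt; apply/negP => qx; have := sub q; rewrite !inE qx QI// qQ.
  by move=> /(_ isT).
rewrite -(@card_basis_viol d T I F V k) //.
- apply/subset_leq_card/subsetP => B; rewrite inE => /andP[/FP[BI cB [l [l0 pE]] xB] Vk].
  rewrite inE BI cB eqxx /=; apply/asboolP; exists (xv B); split=> //; first exact/eqP.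
  (* On [B] the strict point [x0] gives [a q . (xv B - x0) > 0]; the positive multipliers turn this
     into [a p . (xv B - x0) < 0]. *)
  apply: (@lt_trans _ _ (dotprod (a p) x0)); last exact: x0I.
  rewrite -subr_lt0 -dotprodBr -oppr_gt0 -dotprodNl pE dotprod_suml.
  have [q qB] : exists q, q \in B by apply/set0Pn; rewrite -card_gt0 cB.
  have pos r : r \in B -> 0 < dotprod (l r *: a r) (xv B - x0).
    move=> rB; rewrite dotprodZl mulr_gt0 ?l0// dotprodBr xB// subr_gt0 x0I//.
    exact: (subsetP BI).
  rewrite (bigD1 q)//= ltr_pwDl ?pos//; apply: sumr_ge0 => r /andP[rB _].
  exact/ltW/pos.
- move=> B /FP[BI cB _ xB]; split=> //.
    by apply/subsetP => q; rewrite inE => /andP[].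
  rewrite -setI_eq0; apply/eqP/setP => q; rewrite !inE.
  by have [/xB ->|//] := boolP (q \in B); rewrite ltxx andbF.
move=> M MI Mk.
have QI : I :\: M \subset I by rewrite subsetDl.
have dQ : deep a (I :\: M) 0 by apply: (deep_setD (m := k)); rewrite ?addn0.
have IDD : I :\: (I :\: M) = M.
  apply/setP => q; rewrite !inE.
  by case: (boolP (q \in M)) => [/(subsetP MI) ->|_]; case: (q \in I).
have [x [l [fx cx l0 pE]]] := lp_optimum sI QI pI dQ
  (fun q qQ => ltW (x0I q (subsetP QI q qQ))).
pose B := tight a b (I :\: M) x.
have BQ : B \subset I :\: M by apply/subsetP => q; rewrite inE => /andP[].
have BI := subset_trans BQ QI.
have BF : B \in F by rewrite inE BI cx eqxx /=; apply/asboolP; exists l.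
have xvE : xv B = x.
  have [_ _ _ xB] := FP B BF; apply: (vertex_uniq sI BI cx) => // q.
  by rewrite inE => /andP[_ /eqP].
apply/eqP/cards1P; exists B; apply/setP => C; rewrite in_set1 in_set.
apply/idP/eqP => [/and3P[CF dCM VC]|->]; last first.
  rewrite BF /V xvE; move: BQ; rewrite subsetD => /andP[_ ->] /=.
  by rewrite -[in X in _ \subset X]IDD; apply/aboveS.
have [CI cC [l' [l0' pE']] xC] := FP C CF.
have CQ : C \subset I :\: M by rewrite subsetD CI.
have fC : forall q, q \in I :\: M -> dotprod (a q) (xv C) <= b q.
  by apply/(aboveS _ _ QI); rewrite IDD.
have val (A : {set T}) (m : T -> R) y : - a p = \sum_(q in A) m q *: a q ->
    \sum_(q in A) m q * dotprod (a q) y = - dotprod (a p) y.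
  move=> e; rewrite -dotprodNl e dotprod_suml.
  by apply: eq_bigr => q _; rewrite dotprodZl.
(* Weak duality: a point tight on the support of the multipliers is optimal. Used in both
   directions, it equates the values at [x] and [xv C]. *)
have vle (A : {set T}) (m : T -> R) y z : - a p = \sum_(q in A) m q *: a q ->
   (forall q, q \in A -> 0 < m q) -> A \subset I :\: M ->
   (forall q, q \in I :\: M -> dotprod (a q) y <= b q) ->
   (forall q, q \in A -> dotprod (a q) z = b q) ->
   - dotprod (a p) y <= - dotprod (a p) z.
  move=> e m0 /subsetP AQ fy tz; rewrite -(val _ _ y e) -(val _ _ z e).
  by apply: ler_sum => q qA; rewrite ler_pM2l ?m0// tz// fy// AQ.
have [_ _ _ xB] := FP B BF; rewrite xvE in xB.
have eqv : - dotprod (a p) (xv C) = - dotprod (a p) x.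
  by apply: le_anti; rewrite (vle B l)//= (vle C l').
(* Complementary slackness: nonnegative slacks with positive multipliers sum to zero. Hence [B] and
   [C] are both the tight set of [xv C]. *)
have tC q : q \in B -> dotprod (a q) (xv C) = b q.
  move=> qB; have qI := subsetP BQ _ qB.
  have : \sum_(q in B) l q * (b q - dotprod (a q) (xv C)) = 0.
    under eq_bigr => r rB do rewrite mulrBr -[in X in X - _](xB r rB).
    by rewrite sumrB !(val B l)// eqv subrr.
  move/psumr_eq0P => /(_ _ q qB) H; apply/eqP; rewrite eq_sym -subr_eq0.
  have /H/eqP : forall r, r \in B -> 0 <= l r * (b r - dotprod (a r) (xv C)).
    move=> r rB; apply: mulr_ge0; first exact/ltW/l0.
    rewrite subr_ge0 fC//.
    exact: (subsetP BQ).
  by rewrite mulf_eq0 gt_eqF ?l0.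
have [_ s2] := sI.
have tI (A : {set T}) : A \subset I -> #|A| = d.+1 ->
    (forall q, q \in A -> dotprod (a q) (xv C) = b q) -> A = tight a b I (xv C).
  move=> /subsetP AI cA tA; apply/eqP; rewrite eqEcard cA s2 andbT.
  by apply/subsetP => q qA; rewrite inE AI// tA/=.
by rewrite (tI C)// (tI B).
Qed.

(** From a vertex of the level-0 cell, [u] stays on one tight hyperplane [p] and moves strictly
    inside the other tight ones; a short step also respects the hyperplanes outside [B]. *)
Lemma exists_facet d (a : T -> 'rV[R]_d.+1) (b : T -> R) I x0 :
  simple_arrangement a b I -> deep a I 0 ->
  (forall q, q \in I -> dotprod (a q) x0 < b q) ->
  exists p, exists x, [/\ p \in I, a p != 0, dotprod (a p) x = b p &
    forall q, q \in I :\ p -> dotprod (a q) x < b q].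
Proof.
move=> sI dI x0I.
have [x fx cx] := exists_feasible_vertex sI (subxx _) dI (fun q qI => ltW (x0I q qI)).
set B := tight a b I x in cx.
have BI : B \subset I by apply/subsetP => q; rewrite inE => /andP[].
have sep := simple_sep sI BI cx.
have [p pB] : exists p, p \in B by apply/set0Pn; rewrite -card_gt0 cx.
have [w wB] := basis_solve cx sep (fun=> 1).
have [u uB] := basis_solve cx sep (fun q => (q == p)%:R - 1).
have xB q : q \in B -> dotprod (a q) x = b q by rewrite inE => /andP[_ /eqP].
have [t t0 tI] : exists2 t, 0 < t & forall q, q \in I :\: B ->
    t * dotprod (a q) u < b q - dotprod (a q) x.
  pose g q := b q - dotprod (a q) x.
  have g0 q : q \in I :\: B -> 0 < g q.
    rewrite !inE => /andP[nB qI]; rewrite subr_gt0 lt_neqAle fx// andbT.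
    by move: nB; rewrite qI.
  have pos q : 0 < 1 + `|dotprod (a q) u| by rewrite ltr_wpDr.
  (* The added 1 avoids a zero denominator and makes the resulting inequality strict. *)
  pose h q := g q / (1 + `|dotprod (a q) u|).
  have [E|[q0 q0P]] := set_0Vmem (I :\: B).
    by exists 1 => // q; rewrite E inE.
  have [q /= qP qmin] := @arg_minP _ _ _ q0 (mem (I :\: B)) h q0P.
  have hq : 0 < h q by rewrite divr_gt0// g0.
  exists (h q) => // r rP; have := qmin r rP; rewrite /= {2}/h ler_pdivlMr// => hr.
  apply: lt_le_trans hr; rewrite ltr_pM2l//.
  by rewrite (le_lt_trans (ler_norm _))// ltrDr.
exists p, (x + t *: u); split.
- exact: (subsetP BI).
- by apply/eqP => ap; have := wB p pB; rewrite ap dotprod0l => /eqP; rewrite eq_sym oner_eq0.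
- by rewrite dotprodDr dotprodZr uB// eqxx subrr mulr0 addr0 xB.
move=> q; rewrite !inE => /andP[qp qI]; rewrite dotprodDr dotprodZr.
have [qB|nB] := boolP (q \in B).
  by rewrite uB// (negbTE qp) xB// sub0r mulrN1 gtrDl oppr_lt0.
by rewrite addrC -ltrBrDr tI// inE nB.
Qed.

Lemma exists_hyperplane_basis d (c : 'rV[R]_d.+1) : c != 0 ->
  exists2 W : 'M[R]_(d, d.+1), row_free W & W *m c^T = 0.
Proof.
move=> c0.
have rK : \rank (kermx c^T) = d by rewrite mxrank_ker mxrank_tr rank_rV c0 subn1.
have : exists2 W : 'M[R]_(\rank (kermx c^T), d.+1), row_free W & W *m c^T = 0.
  exists (row_base (kermx c^T)); first exact: row_base_free.
  by apply/sub_kermxP; rewrite eq_row_base.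
by rewrite rK.
Qed.

Lemma above_setD1 d (a : T -> 'rV[R]_d) b I p x :
  above a b (I :\ p) x = above a b I x :\ p.
Proof. by apply/setP => q; rewrite !inE andbA. Qed.

Lemma deepW d (a : T -> 'rV[R]_d) I k m : (m <= k)%N -> deep a I k -> deep a I m.
Proof. by move=> mk dI u /dI; apply: leq_ltn_trans. Qed.

(** [H] is the bound one dimension lower. The hyperplane of [p] is parametrised by [x + u *m W],
    with the facet point [x] as origin, and [a'], [b'] are the traces of the other hyperplanes;
    adding [p] turns a vertex of the trace into a vertex of the same level. *)
Lemma card_restricted_vertices d (a : T -> 'rV[R]_d.+1) (b : T -> R) I p x k :
  (forall (a' : T -> 'rV[R]_d) b' I' x0,
    simple_arrangement a' b' I' -> deep a' I' k ->
    (forall q, q \in I' -> dotprod (a' q) x0 < b' q) ->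
    (d.+1 * 'C(k + d, d) <= #|lek_vertices a' b' I' k|)%N) ->
  simple_arrangement a b I -> deep a I k ->
  p \in I -> a p != 0 -> dotprod (a p) x = b p ->
  (forall q, q \in I :\ p -> dotprod (a q) x < b q) ->
  (d.+1 * 'C(k + d, d) <= #|[set B in lek_vertices a b I k | p \in B]|)%N.
Proof.
move=> H sI dI pI ap xp xI.
have [W Wfree Wp] := exists_hyperplane_basis ap.
pose a' q := a q *m W^T.
pose b' q := b q - dotprod (a q) x.
have a'E q u : dotprod (a' q) u = dotprod (a q) (u *m W).
  by rewrite !dotprodE /a' trmx_mul mulmxA.
have pW u : dotprod (a p) (u *m W) = 0.
  by rewrite dotprodC dotprodE -mulmxA Wp mulmx0 mxE.
have W0 u : u != 0 -> u *m W != 0.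
  by apply: contraNneq => uW; apply/eqP/(row_free_inj Wfree); rewrite uW mul0mx.
have [s1 s2] := sI.
have tight' u : tight a b I (x + u *m W) = p |: tight a' b' (I :\ p) u.
  apply/setP => q; rewrite !inE /b' a'E dotprodDr.
  have [->|qp] /= := eqVneq q p; first by rewrite pI pW xp addr0 eqxx.
  by congr andb; rewrite [in RHS]eq_sym subr_eq [in RHS]eq_sym addrC.
have tight0 u : tight a (fun=> 0) I (u *m W) = p |: tight a' (fun=> 0) (I :\ p) u.
  apply/setP => q; rewrite !inE a'E.
  by have [->|qp] //= := eqVneq q p; rewrite pI pW eqxx.
have above' u : above a b I (x + u *m W) = above a' b' (I :\ p) u.
  apply/setP => q; rewrite !inE /b' a'E dotprodDr.
  have [->|qp] /= := eqVneq q p; first by rewrite pW xp addr0 ltxx andbF.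
  by congr andb; rewrite ltrBlDl.
have above0 u : above a (fun=> 0) I (u *m W) = above a' (fun=> 0) (I :\ p) u.
  apply/setP => q; rewrite !inE a'E.
  by have [->|qp] //= := eqVneq q p; rewrite pW ltxx andbF.
have pT f u : #|p |: tight a' f (I :\ p) u| = #|tight a' f (I :\ p) u|.+1.
  by rewrite cardsU1 !inE eqxx.
have sI' : simple_arrangement a' b' (I :\ p).
  split=> [u /W0/s1|u]; first by rewrite tight0 pT.
  by rewrite -ltnS -pT -tight'.
have dI' : deep a' (I :\ p) k by move=> u /W0/dI; rewrite above0.
apply: leq_trans (H a' b' (I :\ p) 0 sI' dI' _) _.
  by move=> q /xI qx; rewrite dotprod0r subr_gt0.
rewrite -(@card_in_imset _ _ (fun B => p |: B)).
  apply/subset_leq_card/subsetP => _ /imsetP[B + ->].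
  rewrite !inE eqxx andbT subsetD1 => /and3P[/andP[BI pB] /eqP cB /asboolP[u uB uk]].
  rewrite subUset sub1set pI BI cardsU1 pB cB eqxx /=; apply/asboolP.
  exists (x + u *m W); last by rewrite above'.
  move=> q; rewrite !inE => /orP[/eqP ->|/uB]; rewrite dotprodDr.
    by rewrite pW addr0.
  by rewrite a'E => ->; rewrite addrC subrK.
move=> A B; rewrite !inE !subsetD1 => /and3P[/andP[_ pA] _ _] /and3P[/andP[_ pB] _ _] e.
by rewrite -(setU1K pA) e setU1K.
Qed.

(** In the step to dimension [d+1] and level [k+1], the three families contribute
    [(d+2) C(k+d+1, d+1)], [(d+1) C(k+d+1, d)] and [C(k+d+1, d)], which add up by Pascal's rule. *)
Lemma card_lek_vertices d k : forall (a : T -> 'rV[R]_d) (b : T -> R) I x0,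
  simple_arrangement a b I -> deep a I k ->
  (forall q, q \in I -> dotprod (a q) x0 < b q) ->
  (d.+1 * 'C(k + d, d) <= #|lek_vertices a b I k|)%N.
Proof.
elim: d k => [|d IHd] k.
  (* In dimension 0 the empty set is a vertex, of level 0 because of [x0]. *)
  move=> a b I x0 sI dI x0I; rewrite bin0 mul1n card_gt0; apply/set0Pn; exists set0.
  rewrite inE sub0set cards0 eqxx /=; apply/asboolP; exists x0; first by move=> q; rewrite inE.
  rewrite (_ : above _ _ _ _ = set0) ?cards0//; apply/setP => q; rewrite !inE.
  by apply/negP => /andP[/x0I]; rewrite ltNge => /negP nx /ltW.
elim: k => [|k IHk] a b I x0 sI dI x0I;
  have [p [x [pI ap xp xI]]] := exists_facet sI (deepW (leq0n _) dI) x0I;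
  have := card_restricted_vertices (IHd _) sI dI pI ap xp xI;
  have := card_exact_level sI pI dI x0I;
  set E := [set B : {set T} | _]; set L := [set B in _ | _].
  (* For [k = 0] the families [E] and [L] alone give [1 + (d+1)]. *)
  have EL : [disjoint E & L].
    rewrite -setI_eq0; apply/eqP/setP => B; rewrite !inE; apply/negP.
    move=> /andP[/and3P[BI /eqP cB /asboolP[y [yB yk yp]]] /andP[_ pB]].
    by rewrite yB// ltxx in yp.
  have : (#|E :|: L| <= #|lek_vertices a b I 0|)%N.
    apply/subset_leq_card/subsetP => B; rewrite !inE.
    move=> /orP[/and3P[-> -> /asboolP[y [yB yk yp]]]|/andP[]//].
    by apply/asboolP; exists y; rewrite ?yk.
  rewrite cardsU disjoint_setI0// cards0 subn0 !add0n !binn; lia.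
have dI' : deep a (I :\ p) k by apply: (@deep_setD _ _ _ _ _ _ _ 1); rewrite ?cards1.
have IH := IHk a b (I :\ p) x0 (simple_arrangementS (subD1set _ _) sI) dI' _.
have {}IH := IH (fun q qI => x0I q (subsetP (subD1set _ _) q qI)).
move: IH; set K := lek_vertices a b (I :\ p) k => IH.
(* Putting [p] back raises the level by at most one. *)
have KP B : B \in K -> p \notin B /\ B \in lek_vertices a b I k.+1.
  rewrite !inE subsetD1 => /and3P[/andP[BI pB] cB /asboolP[y yB yk]]; split=> //.
  rewrite BI cB /=; apply/asboolP; exists y => //.
  move: yk; rewrite above_setD1 (cardsD1 p (above a b I y)); case: (p \in _); lia.
have EL : [disjoint E & L].
  rewrite -setI_eq0; apply/eqP/setP => B; rewrite !inE; apply/negP.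
  move=> /andP[/and3P[BI /eqP cB /asboolP[y [yB yk yp]]] /andP[_ pB]].
  by rewrite yB// ltxx in yp.
(* At a vertex of [E], [p] is not counted in the level, so deleting it leaves [k.+1], too much for
   [K]; the members of [L] contain [p]. *)
have KEL : [disjoint K & E :|: L].
  rewrite -setI_eq0; apply/eqP/setP => B; rewrite in_set0; apply/negP.
  rewrite in_setI in_setU => /andP[BK]; have [pB _] := KP B BK.
  case/orP; last by rewrite inE (negbTE pB) andbF.
  rewrite inE => /and3P[BI /eqP cB /asboolP[y [yB yk yp]]].
  move: BK; rewrite inE => /and3P[_ _ /asboolP[z zB]].
  rewrite -(vertex_uniq sI BI cB yB zB) above_setD1.
  have -> : above a b I y :\ p = above a b I y.
    by apply/setDidPl; rewrite disjoint_sym disjoints1 inE negb_and -leNgt ltW ?orbT.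
  by rewrite yk ltnn.
have : (#|K :|: (E :|: L)| <= #|lek_vertices a b I k.+1|)%N.
  apply/subset_leq_card/subsetP => B; rewrite in_setU => /orP[/KP[]//|].
  rewrite in_setU => /orP[]; rewrite !inE.
    move=> /and3P[-> -> /asboolP[y [yB yk yp]]].
    by apply/asboolP; exists y; rewrite ?yk.
  by move=> /andP[].
rewrite cardsU disjoint_setI0// cards0 subn0 [in X in (_ + X)%N]cardsU.
rewrite disjoint_setI0// cards0 subn0.
rewrite (_ : (k.+1 + d.+1 = (k + d.+1).+1)%N)// binS (addSnnS k d).
move: IH; nia.
Qed.

End VertexCount.

(** * General position *)

Section GeneralPosition.
Local Open Scope fset_scope.
Local Open Scope ring_scope.
Variables (R : realType) (d : nat).
Implicit Types (S T B : {fset 'rV[R]_d}) (x y u : 'rV[R]_d).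

(** Homogeneous coordinates: affine relations among points become linear relations among the rows
    [(1, x)]. *)
Let lift_mx T : 'M[R]_(size T, 1 + d) :=
  \matrix_i row_mx 1 (tnth (in_tuple T) i).

Let mul_lift_mx T (v : 'rV[R]_(1 + d)) i :
  (v *m (lift_mx T)^T) 0 i = lsubmx v 0 0 + dotprod (rsubmx v) (tnth (in_tuple T) i).
Proof.
rewrite !mxE big_split_ord /= big_ord1; congr (_ + _).
  by rewrite !mxE (unsplitK (inl _)) !mxE mulr1.
by apply: eq_bigr => j _; rewrite !mxE (unsplitK (inr _)).
Qed.

Let coeff T (c : 'rV[R]_(size T)) x : R := \sum_i c 0 i *+ (tnth (in_tuple T) i == x).

Let coeffE T (c : 'rV[R]_(size T)) i : coeff c (tnth (in_tuple T) i) = c 0 i.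
Proof.
have tinj : injective (tnth (in_tuple T)) by apply/tuple_uniqP; exact: fset_uniq.
rewrite /coeff (bigD1 i)//= eqxx big1 ?addr0// => j ji.
by rewrite (inj_eq tinj) (negbTE ji).
Qed.

Let mul_coeff T (c : 'rV[R]_(size T)) :
  c *m lift_mx T = row_mx (\sum_(x <- T) coeff c x)%:M (\sum_(x <- T) coeff c x *: x).
Proof.
rewrite mulmx_sum_row; apply/rowP => j; rewrite [LHS]summxE.
case: (split_ordP j) => k ->; rewrite ?row_mxEl ?row_mxEr.
  rewrite [RHS]mxE [in RHS]ord1 mulr1n [RHS]big_tnth; apply: eq_bigr => i _.
  by rewrite coeffE !mxE (unsplitK (inl _)) !mxE ord1 mulr1.
rewrite [in RHS]big_tnth [RHS]summxE; apply: eq_bigr => i _.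
by rewrite coeffE !mxE (unsplitK (inr _)).
Qed.

Let lift_mx_free T : affinely_independent T -> row_free (lift_mx T).
Proof.
move=> indT; rewrite -kermx_eq0; apply/rowV0P => c /sub_kermxP cA.
apply/rowP => i; rewrite mxE -coeffE; apply: indT; last exact: mem_tnth.
  have := congr1 (fun v => lsubmx v 0 0) cA.
  by rewrite mul_coeff row_mxKl !mxE mulr1n.
by have := congr1 rsubmx cA; rewrite mul_coeff row_mxKr linear0.
Qed.

(** The lifted rows form a basis, so [(0, v)] is a combination of them. *)
Lemma affinely_independent_span T v : affinely_independent T -> #|` T| = d.+1 ->
  exists2 c : 'rV[R]_d -> R, \sum_(x <- T) c x = 0 & v = \sum_(x <- T) c x *: x.
Proof.
move=> /lift_mx_free/eqP r cT.
have full : row_full (lift_mx T) by rewrite /row_full r cT.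
have /submxP[c] := submx_full (row_mx 0 v) full; rewrite mul_coeff => cE.
exists (coeff c); last by have := congr1 rsubmx cE; rewrite !row_mxKr.
have := congr1 (fun v => lsubmx v 0 0) cE.
by rewrite !row_mxKl !mxE mulr1n.
Qed.

(** All lifted rows are annihilated by the nonzero vector [(-b, u)], so their rank is at most
    [d]. *)
Lemma affinely_independent_on_hyperplane T u b : affinely_independent T ->
  u != 0 -> (forall x, x \in T -> dotprod u x = b) -> (#|` T| <= d)%N.
Proof.
move=> indT u0 uT.
have r : \rank (lift_mx T)^T = size T by rewrite mxrank_tr; apply/eqP/lift_mx_free.
have : ~~ row_free (lift_mx T)^T.
  rewrite -kermx_eq0; apply/negP => /rowV0P/(_ (row_mx (- b)%:M u)).
  have -> : (row_mx (- b)%:M u <= kermx (lift_mx T)^T)%MS.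
    apply/sub_kermxP/rowP => i; rewrite mul_lift_mx row_mxKl row_mxKr uT ?mem_tnth//.
    by rewrite !mxE mulr1n addNr.
  by move=> /(_ isT)/(congr1 rsubmx)/eqP; rewrite row_mxKr linear0 (negbTE u0).
by rewrite /row_free neq_ltn [X in _ || X]ltnNge rank_leq_row orbF r.
Qed.

(** At most [d] rows in dimension [d+1] have a common nonzero annihilator. Its linear part is
    nonzero, for otherwise a point of [T] would make the constant part vanish too. *)
Lemma exists_hyperplane_through T : (0 < d)%N -> (#|` T| <= d)%N ->
  exists2 u, u != 0 & exists b, forall x, x \in T -> dotprod u x = b.
Proof.
move=> d0 Td; have [->|[y yT]] := fset_0Vmem T.
  exists (const_mx 1) => //; last by exists 0 => x; rewrite inE.
  by apply/eqP => /rowP/(_ (Ordinal d0)); rewrite !mxE => /eqP; rewrite oner_eq0.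
have : kermx (lift_mx T)^T != 0.
  rewrite kermx_eq0 /row_free neq_ltn mxrank_tr.
  by rewrite (leq_ltn_trans (rank_leq_row _)).
move=> /rowV0Pn[v /sub_kermxP vA v0].
have vT x : x \in T -> dotprod (rsubmx v) x = - lsubmx v 0 0.
  move=> /(@tnthP _ _ (in_tuple T))[i ->].
  by apply/eqP; rewrite -addr_eq0 addrC -mul_lift_mx vA mxE.
exists (rsubmx v); last by exists (- lsubmx v 0 0).
apply: contraNneq v0 => v0; have := vT y yT; rewrite v0 dotprod0l => /esym/eqP.
rewrite oppr_eq0 => /eqP l0; rewrite -[v]hsubmxK v0.
by rewrite [lsubmx v]mx11_scalar l0 raddf0 row_mx0.
Qed.

Lemma affine_span_subset_hyperplane T u b y :
  (forall x, x \in T -> dotprod u x = b) -> affine_span T y -> dotprod u y = b.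
Proof.
move=> uT [c [c1 ->]]; rewrite dotprod_sumr -[RHS]mul1r -c1 mulr_suml.
by apply: eq_big_seq => x xT; rewrite dotprodZr uT.
Qed.

Lemma sub_affine_span T x : x \in T -> affine_span T x.
Proof.
move=> xT; exists (fun y => (y == x)%:R); split.
  rewrite (big_fsetD1 x)//= eqxx big_seq big1 ?addr0// => y.
  by rewrite !inE => /andP[/negbTE ->].
rewrite (big_fsetD1 x)//= eqxx scale1r big_seq big1 ?addr0// => y.
by rewrite !inE => /andP[/negbTE ->]; rewrite scale0r.
Qed.

Lemma affinely_independentU1 T y : affinely_independent T ->
  ~ affine_span T y -> affinely_independent (y |` T).
Proof.
move=> indT ny c; have yT : y \notin T by apply/negP => /sub_affine_span.
rewrite !big_fsetU1//= => c0 c1 x.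
have [cy|cy] := eqVneq (c y) 0.
  rewrite cy add0r in c0; rewrite cy scale0r add0r in c1.
  by rewrite !inE => /orP[/eqP ->//|]; exact: indT.
case: ny; exists (fun x => - (c y)^-1 * c x); split.
  rewrite -mulr_sumr; move/eqP: c0; rewrite addrC addr_eq0 => /eqP ->.
  by rewrite mulrNN mulVf.
under eq_bigr do rewrite -scalerA.
rewrite -scaler_sumr; move/eqP: c1; rewrite addrC addr_eq0 => /eqP ->.
by rewrite scaleNr scalerN opprK scalerA mulVf// scale1r.
Qed.

Lemma general_position_on_hyperplane S T u b : general_position S -> T `<=` S ->
  u != 0 -> (forall x, x \in T -> dotprod u x = b) -> (#|` T| <= d)%N.
Proof.
move=> gS TS u0 uT; rewrite leqNgt; apply/negP => dT.
have [s [us sz sT]] : exists s : seq 'rV[R]_d, [/\ uniq s, size s = d.+1 & {subset s <= T}].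
  exists (take d.+1 T); rewrite take_uniq ?fset_uniq// size_takel//; split=> // x.
  exact: mem_take.
pose B := [fset x in s].
have cB : #|` B| = d.+1 by rewrite card_fseq undup_id.
have BT : B `<=` T by apply/fsubsetP => x; rewrite inE => /sT.
have indB := gS _ (fsubset_trans BT TS); rewrite cB leqnn in indB.
have := affinely_independent_on_hyperplane (indB isT) u0 (fun x xB => uT x (fsubsetP BT x xB)).
by rewrite cB ltnn.
Qed.

(** The point moves from [x0] along the moment curve [(s, s^2, ..., s^d)]: each hyperplane becomes a
    nonzero polynomial in [s], which excludes finitely many values. *)
Lemma generic_point (l : seq ('rV[R]_d * R)) x0 (e : R) : 0 < e ->
  (forall h, h \in l -> h.1 != 0) ->
  exists2 x : 'rV[R]_d, (forall i, `|x 0 i - x0 0 i| < e) &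
    forall h, h \in l -> dotprod h.1 x != h.2.
Proof.
move=> e0 l0.
pose P (h : 'rV[R]_d * R) : {poly R} :=
  \sum_(i < d) h.1 0 i *: 'X^(i.+1) + (dotprod h.1 x0 - h.2)%:P.
have P0 h : h \in l -> P h != 0.
  move=> /l0; apply: contraNneq => Ph; apply/eqP/rowP => j.
  have := congr1 (fun p : {poly R} => p`_j.+1) Ph.
  rewrite coef0 coefD coefC addr0 coef_sum (bigD1 j)//= coefZ coefXn eqxx mulr1.
  rewrite big1 ?addr0 ?mxE// => i ij.
  by rewrite coefZ coefXn eqSS eq_sym (inj_eq val_inj) (negbTE ij) mulr0.
pose Q := \prod_(h <- l) P h.
have Q0 : Q != 0 by rewrite prodf_seq_neq0; apply/allP => h /P0.
pose m := Num.min e 1.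
have m0 : 0 < m by rewrite lt_min e0 ltr01.
(* These [size Q] distinct candidates outnumber the roots of [Q]; the offset 2 keeps each of them
   below [m]. *)
pose rs := [seq m / j.+2%:R | j <- iota 0 (size Q)].
have [s sr Qs] : exists2 s, s \in rs & ~~ root Q s.
  apply/hasP; rewrite has_predC; apply/negP => ar.
  have := max_poly_roots Q0 ar; rewrite size_map size_iota ltnn => H.
  suff: false by []; apply: H.
  rewrite map_inj_uniq ?iota_uniq// => i j /(mulfI (lt0r_neq0 m0))/invr_inj/eqP.
  by rewrite eqr_nat => /eqP[].
have [s0 sm] : 0 < s /\ s < m.
  have /mapP[j _ ->] := sr; split; first by rewrite divr_gt0.
  by rewrite ltr_pdivrMr// ltr_pMr// ltr1n.
have se : s < e by move: sm; rewrite lt_min => /andP[].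
have s1 : s < 1 by move: sm; rewrite lt_min => /andP[].
exists (x0 + \row_i s ^+ i.+1) => [i|h hl].
  rewrite !mxE addrAC subrr add0r ger0_norm ?exprn_ge0 ?ltW//.
  by apply: le_lt_trans se; rewrite exprS ler_piMr ?exprn_ile1 ?ltW.
apply: contra Qs => /eqP hx; rewrite /root horner_prod; apply/eqP.
apply/eqP; rewrite prodf_seq_eq0; apply/hasP; exists h => //=.
rewrite hornerD hornerC horner_sum -hx dotprodDr.
rewrite [X in _ + X](_ : _ = - dotprod h.1 (\row_i s ^+ i.+1)); last by ring.
rewrite subr_eq0; apply/eqP.
by apply: eq_bigr => i _; rewrite hornerZ hornerXn mxE.
Qed.

(** It suffices to avoid one hyperplane through each subset of at most [d] points, since that
    hyperplane contains the affine span of the subset. *)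
Lemma general_positionU1_near S x0 (e : R) : (0 < d)%N -> 0 < e -> general_position S ->
  exists x : 'rV[R]_d, [/\ x \notin S, forall i, `|x 0 i - x0 0 i| < e & general_position (x |` S)].
Proof.
move=> d0 e0 gS.
have /choice[h hP] : forall T, exists h : 'rV[R]_d * R, (#|` T| <= d)%N ->
    h.1 != 0 /\ forall x, x \in T -> dotprod h.1 x = h.2.
  move=> T; have [Td|] := leqP #|` T| d; last by exists (0, 0).
  by have [u u0 [b ub]] := exists_hyperplane_through d0 Td; exists (u, b).
pose l := [seq h T | T <- fpowerset S & (#|` T| <= d)%N].
have l0 g : g \in l -> g.1 != 0.
  by move=> /mapP[T + ->]; rewrite mem_filter => /andP[/hP[]].
have [x xe xl] := generic_point x0 e0 l0.
have xT T : T `<=` S -> (#|` T| <= d)%N -> dotprod (h T).1 x != (h T).2.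
  by move=> TS Td; apply: xl; apply: map_f; rewrite mem_filter Td fpowersetE.
exists x; split=> //.
  apply/negP => xS; have T1 : (#|` [fset x]| <= d)%N by rewrite cardfs1.
  have := xT [fset x]; rewrite fsub1set xS T1 => /(_ isT isT).
  by have [_ ->] := hP _ T1; rewrite ?eqxx// inE.
move=> T TS Td; have [xT'|xT'] := boolP (x \in T); last first.
  apply: gS => //; apply/fsubsetP => y yT; have := fsubsetP TS y yT.
  by rewrite !inE => /orP[/eqP yx|//]; rewrite -yx yT in xT'.
have sub : T `\ x `<=` S.
  apply/fsubsetP => y; rewrite !inE => /andP[yx /(fsubsetP TS)].
  by rewrite !inE (negbTE yx).
have card : (#|` T `\ x| <= d)%N by rewrite -ltnS; move: Td; rewrite (cardfsD1 x) xT'.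
rewrite -(fsetD1K xT'); apply: affinely_independentU1; first by apply: gS => //; apply: leqW.
have [_ hT] := hP _ card.
by move=> /(affine_span_subset_hyperplane hT)/eqP; apply/negP/xT.
Qed.

(** A point of the hyperplane outside the span would complete [T] to [d+1] affinely independent
    points on one hyperplane. *)
Lemma affine_span_hyperplane S T u b : general_position S -> T `<=` S -> #|` T| = d ->
  u != 0 -> (forall x, x \in T -> dotprod u x = b) ->
  affine_span T = [set y | dotprod u y = b]%classic.
Proof.
move=> gS TS Td u0 uT; apply/seteqP; split=> y /=.
  exact: affine_span_subset_hyperplane uT.
move=> uy; apply: contrapT => ny.
have indT : affinely_independent T by apply: gS => //; rewrite Td.
have yT : y \notin T by apply/negP => /sub_affine_span.
have := affinely_independent_on_hyperplane (affinely_independentU1 indT ny) u0.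
rewrite cardfsU1 yT Td ltnn => H; suff: false by []; apply: (H b) => x.
by rewrite !inE => /orP[/eqP ->//|/uT].
Qed.

End GeneralPosition.

(** * Centre points *)

Section Helly.
Import fintype mathcomp.boot.finset.
Local Open Scope ring_scope.
Variables (R : realType) (d : nat) (J : finType).
Implicit Types (A : {set J}) (x y z : 'rV[R]_d).

(** The vectors [(1, x j)] live in dimension [d+1], hence are dependent; the splitting by sign takes
    place in [helly]. *)
Lemma radon A (x : J -> 'rV[R]_d) : (d.+1 < #|A|)%N ->
  exists l : J -> R, [/\ \sum_(j in A) l j = 0, \sum_(j in A) l j *: x j = 0 &
    exists2 j, j \in A & l j != 0].
Proof.
move=> dA.
pose X : 'M[R]_(#|A|, 1 + d) := \matrix_i row_mx 1 (x (enum_val i)).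
have : kermx X != 0.
  rewrite kermx_eq0 /row_free neq_ltn; apply/orP; left.
  exact: leq_ltn_trans (rank_leq_col _) dA.
move=> /rowV0Pn[c /sub_kermxP cX c0].
pose l j := \sum_i c 0 i *+ (enum_val i == j).
have lE i : l (enum_val i) = c 0 i.
  rewrite /l (bigD1 i)//= eqxx mulr1n big1 ?addr0// => j ji.
  by rewrite (inj_eq enum_val_inj) (negbTE ji).
exists l; split.
- have := congr1 (fun v : 'rV[R]_(1 + d) => v 0 (lshift d 0)) cX; rewrite [RHS]mxE [in LHS]mxE.
  rewrite [in X in _ -> X]big_enum_val => H; rewrite -[RHS]H.
  by apply: eq_bigr => i _; rewrite lE !mxE (unsplitK (inl _)) !mxE mulr1.
- rewrite big_enum_val; apply/rowP => k.
  have := congr1 (fun v : 'rV[R]_(1 + d) => v 0 (rshift 1 k)) cX; rewrite [RHS]mxE [in LHS]mxE => H.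
  rewrite summxE [RHS]mxE -[RHS]H.
  by apply: eq_bigr => i _; rewrite lE !mxE (unsplitK (inr _)).
have [i ci] : exists i, c 0 i != 0.
  apply/existsP; apply: contraNT c0; rewrite negb_exists => /forallP ci.
  by apply/eqP/rowP => i; rewrite mxE; have := ci i; rewrite negbK => /eqP.
by exists (enum_val i); rewrite ?enum_valP// lE.
Qed.

Definition convex_pred (P : 'rV[R]_d -> Prop) := forall x y (t : R),
  0 <= t -> t <= 1 -> P x -> P y -> P (t *: x + (1 - t) *: y).

(** Unnormalised weights let the induction hypothesis apply to [A :\ j] with the same [w]. *)
Lemma convex_sum (P : 'rV[R]_d -> Prop) A (w : J -> R) (x : J -> 'rV[R]_d) :
  convex_pred P -> A != set0 -> (forall j, j \in A -> 0 < w j /\ P (x j)) ->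
  P ((\sum_(j in A) w j)^-1 *: \sum_(j in A) w j *: x j).
Proof.
move=> cP; have [n] := ubnP #|A|; elim: n A => // n IH A An A0 wA.
have [j jA] := set0Pn _ A0.
have [wj Pj] := wA j jA.
rewrite !(big_setD1 j jA) /=.
have [E|Aj0] := eqVneq (A :\ j) set0.
  by rewrite E !big_set0 !addr0 scalerA mulVf ?scale1r// gt_eqF.
have wAj i : i \in A :\ j -> 0 < w i /\ P (x i) by rewrite inE => /andP[_ /wA].
have PAj := IH _ (leq_trans (proper_card (properD1 jA)) An) Aj0 wAj.
set W := \sum_(i in A :\ j) w i in PAj *; set X := \sum_(i in A :\ j) w i *: x i in PAj *.
have W0 : 0 < W.
  have [i iA] := set0Pn _ Aj0; rewrite /W (bigD1 i)//= ltr_pwDl//.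
    by have [] := wAj i iA.
  by apply: sumr_ge0 => k /andP[/wAj[/ltW]].
have s0 : 0 < w j + W by rewrite addr_gt0.
have t0 : 0 <= w j / (w j + W) by apply: divr_ge0; exact: ltW.
have t1 : w j / (w j + W) <= 1 by rewrite ler_pdivrMr// mul1r lerDl ltW.
have := cP (x j) _ _ t0 t1 Pj PAj.
congr P; rewrite scalerDr !scalerA [(w j + W)^-1 * _]mulrC; congr (_ + _ *: _).
by field; rewrite !gt_eqF.
Qed.

(** By induction on [#|A|], [xs j] meets every condition other than [K j]. A Radon relation yields a
    point that is an average over [P] and also over [N]; for each [j], one of the two averages does
    not involve [xs j]. *)
Lemma helly (K : J -> 'rV[R]_d -> Prop) A :
  (forall j, convex_pred (K j)) ->
  (forall B : {set J}, B \subset A -> (#|B| <= d.+1)%N ->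
     exists x, forall j, j \in B -> K j x) ->
  exists x, forall j, j \in A -> K j x.
Proof.
move=> cK; have [n] := ubnP #|A|; elim: n A => // n IH A An HA.
have [Ad|dA] := leqP #|A| d.+1; first exact: HA.
have [xs xsP] : exists xs : J -> 'rV[R]_d,
    forall j, j \in A -> forall i, i \in A :\ j -> K i (xs j).
  suff /choice[xs H] : forall j, exists x, j \in A -> forall i, i \in A :\ j -> K i x by exists xs.
  move=> j; have [jA|] := boolP (j \in A); last by exists 0.
  have [||x xP] := IH (A :\ j); first exact: leq_trans (proper_card (properD1 jA)) An.
    by move=> B BA; apply: HA; apply: subset_trans BA (subD1set _ _).
  by exists x.
have [l [l0 lx [j0 j0A lj0]]] := radon xs dA.
pose P := [set j in A | 0 < l j]; pose N := [set j in A | l j < 0].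
have sumPN (V : lmodType R) (F : J -> V) : (forall j, l j = 0 -> F j = 0) ->
    \sum_(j in A) F j = \sum_(j in P) F j + \sum_(j in N) F j.
  move=> F0; rewrite (bigID [pred j | 0 < l j])/=; congr (_ + _).
    by apply: eq_bigl => j; rewrite inE.
  rewrite (bigID [pred j | l j == 0])/= big1 ?add0r; last by move=> j /andP[_ /eqP/F0].
  by apply: eq_bigl => j; rewrite inE -leNgt lt_neqAle; case: (j \in A) => //=; rewrite andbC.
have LPN : \sum_(j in P) l j = \sum_(j in N) - l j.
  by rewrite sumrN; apply/eqP; rewrite -addr_eq0 -(sumPN R^o)// l0.
have XPN : \sum_(j in P) l j *: xs j = \sum_(j in N) (- l j) *: xs j.
  under [RHS]eq_bigr do rewrite scaleNr.
  rewrite sumrN; apply/eqP; rewrite -addr_eq0 -(sumPN _ (fun j => l j *: xs j)) ?lx//.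
  by move=> j ->; rewrite scale0r.
have P0 : P != set0.
  apply/negP => /eqP E; move: LPN; rewrite E big_set0 => /esym LN.
  have nj j : j \in N -> l j = 0.
    move=> jN; apply/eqP; rewrite -oppr_eq0; apply/eqP.
    apply: (psumr_eq0P _ LN) => // i; rewrite inE => /andP[_ /ltW].
    by rewrite oppr_ge0.
  have [j0P|j0N|/eqP] := ltgtP 0 (l j0); last by rewrite eq_sym (negbTE lj0).
    have : j0 \in P by rewrite inE j0A.
    by rewrite E inE.
  by have := nj j0; rewrite inE j0A j0N => /(_ isT)/eqP; rewrite (negbTE lj0).
have N0 : N != set0.
  apply/negP => /eqP E; move: LPN; rewrite E big_set0 => LP.
  have [j jP] := set0Pn _ P0; have := jP; rewrite inE => /andP[_ lj].
  have lj00 : l j = 0.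
    by apply: (psumr_eq0P _ LP) => // i; rewrite inE => /andP[_ /ltW].
  by rewrite lj00 ltxx in lj.
exists ((\sum_(j in P) l j)^-1 *: \sum_(j in P) l j *: xs j) => j jA.
have [jP|jP] := boolP (j \in P).
  rewrite LPN XPN; apply: convex_sum => // i; rewrite inE => /andP[iA li].
  rewrite oppr_gt0; split=> //; apply: xsP => //; rewrite inE jA andbT inE.
  by apply: contraTneq jP => ->; rewrite inE iA lt_gtF.
apply: convex_sum => // i iP; have := iP; rewrite inE => /andP[iA li].
split=> //; apply: xsP => //; rewrite !inE jA andbT.
by apply: contraNneq jP => ->.
Qed.

End Helly.

(** * Interior points of convex hulls *)

Section CentrePoint.
Local Open Scope ring_scope.
Variables (R : realType) (d : nat).
Implicit Types (u w x : 'rV[R]_d).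

Definition norm1 u : R := \sum_i `|u 0 i|.

Lemma norm1_gt0 u : u != 0 -> 0 < norm1 u.
Proof.
move=> u0; rewrite lt_def sumr_ge0// andbT; apply: contra u0 => /eqP n0.
apply/eqP/rowP => i; rewrite mxE; apply/normr0_eq0.
exact: (psumr_eq0P _ n0).
Qed.

Lemma norm1_ge0 u : 0 <= norm1 u. Proof. exact: sumr_ge0. Qed.

Lemma dotprod_le_norm1 u w (e : R) : (forall i, `|w 0 i| <= e) -> `|dotprod u w| <= e * norm1 u.
Proof.
move=> we; rewrite /dotprod mulr_sumr; apply: le_trans (ler_norm_sum _ _ _) _.
by apply: ler_sum => i _; rewrite normrM mulrC ler_wpM2r.
Qed.

(* [x] is interior to the convex hull of [Q]; the explicit margin [e] makes
   openness immediate, without compactness of the sphere. *)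
Definition interior_hull (I : choiceType) (f : I -> 'rV[R]_d) (Q : I -> Prop) x :=
  exists2 e : R, 0 < e & forall u, exists2 q, Q q & e * norm1 u <= dotprod u (f q - x).

(** Of the points [q] and [q'] serving [x] and [y], the one further in direction [u] serves both,
    hence every point between. *)
Lemma interior_hull_convex (I : choiceType) (f : I -> 'rV[R]_d) (Q : I -> Prop) :
  convex_pred (interior_hull f Q).
Proof.
move=> x y t t0 t1 [e e0 xe] [e' e'0 ye].
exists (Num.min e e'); first by rewrite lt_min e0.
move=> u; have [q qQ qx] := xe u; have [q' q'Q q'y] := ye u.
have m1 : Num.min e e' * norm1 u <= e * norm1 u by rewrite ler_wpM2r ?norm1_ge0// ge_min lexx.
have m2 : Num.min e e' * norm1 u <= e' * norm1 u by rewrite ler_wpM2r ?norm1_ge0// ge_min lexx orbT.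
move: qx q'y; rewrite !dotprodBr => qx q'y.
have t1' : 0 <= 1 - t by rewrite subr_ge0.
have [qq'|q'q] := leP (dotprod u (f q)) (dotprod u (f q')); [exists q'|exists q] => //.
  rewrite !(dotprodBr, dotprodDr, dotprodZr).
  have h1 : 0 <= t * (dotprod u (f q') - dotprod u x - Num.min e e' * norm1 u).
    by rewrite mulr_ge0//; lra.
  have h2 : 0 <= (1 - t) * (dotprod u (f q') - dotprod u y - Num.min e e' * norm1 u).
    by rewrite mulr_ge0//; lra.
  lra.
rewrite !(dotprodBr, dotprodDr, dotprodZr).
have h1 : 0 <= t * (dotprod u (f q) - dotprod u x - Num.min e e' * norm1 u).
  by rewrite mulr_ge0//; lra.
have h2 : 0 <= (1 - t) * (dotprod u (f q) - dotprod u y - Num.min e e' * norm1 u).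
  by rewrite mulr_ge0//; lra.
lra.
Qed.

(** The centroid works: the values [u . (q - x)] sum to zero, so an upper bound [M] on them bounds
    their absolute values by [(d+1) M]. The coordinates of [u] are fixed combinations of these
    values, so [norm1 u] is bounded by a multiple of [M]. *)
Lemma interior_simplex (T : {fset 'rV[R]_d}) : affinely_independent T -> #|` T| = d.+1 ->
  exists x, interior_hull id (fun q => q \in T) x.
Proof.
move=> indT cT.
have [c cP] : exists c : 'I_d -> 'rV[R]_d -> R, forall i,
    \sum_(x <- T) c i x = 0 /\ delta_mx 0 i = \sum_(x <- T) c i x *: x.
  suff /choice[c H] : forall i, exists c : 'rV[R]_d -> R,
     \sum_(x <- T) c x = 0 /\ delta_mx 0 i = \sum_(x <- T) c x *: x by exists c.
  by move=> i; have [c c0 c1] := affinely_independent_span (delta_mx 0 i) indT cT; exists c.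
pose x := (d.+1%:R^-1 : R) *: \sum_(q <- T) q.
have sumT u : \sum_(q <- T) dotprod u (q - x) = 0.
  under eq_bigr do rewrite dotprodBr.
  rewrite sumrB -dotprod_sumr big_const_seq count_predT cT iter_addr_0.
  by rewrite -[X in _ - X]mulr_natl /x dotprodZr mulVKf ?subrr// pnatr_eq0.
pose C := \sum_i \sum_(q <- T) `|c i q|.
have C0 : 0 <= C by apply: sumr_ge0 => i _; apply: sumr_ge0.
(* The summand 1 makes the final contradiction strict: [norm1 u = M * K] exceeds its bound by
   [M]. *)
pose K := 1 + d.+1%:R * C.
have K0 : 0 < K by rewrite ltr_pwDl// mulr_ge0.
exists x, K^-1; first by rewrite invr_gt0.
move=> u; apply: contrapT => nq.
have [u0|u0] := eqVneq u 0.
  have [q qT] : exists q, q \in T by apply/fset0Pn; rewrite -cardfs_gt0 cT.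
  by apply: nq; exists q => //; rewrite u0 dotprod0l /norm1 big1 ?mulr0// => i _; rewrite mxE normr0.
pose M := norm1 u / K.
have M0 : 0 < M by rewrite divr_gt0 ?norm1_gt0.
have lt_M q : q \in T -> dotprod u (q - x) < M.
  by move=> qT; rewrite ltNge; apply/negP => h; apply: nq; exists q; rewrite // mulrC.
have abs_M q : q \in T -> `|dotprod u (q - x)| <= d.+1%:R * M.
  move=> qT; rewrite ler_norml; apply/andP; split.
    have := sumT u; rewrite (big_fsetD1 q)//= => /eqP; rewrite addr_eq0 => /eqP ->.
    rewrite lerN2; apply: (@le_trans _ _ (\sum_(r <- (T `\ q)%fset) M)).
      by rewrite !big_seq; apply: ler_sum => r; rewrite !inE => /andP[_ /lt_M/ltW].
    rewrite big_const_seq count_predT iter_addr_0 -[X in X <= _]mulr_natl ler_pM2r//.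
    by rewrite ler_nat -cT; apply: fsubset_leq_card; exact: fsubD1set.
  by apply: le_trans (ltW (lt_M q qT)) _; apply: ler_peMl; [exact: ltW|rewrite ler1n].
have : norm1 u <= C * (d.+1%:R * M).
  rewrite /C mulr_suml; apply: ler_sum => i _.
  have [c0 c1] := cP i.
  have -> : u 0 i = \sum_(q <- T) c i q * dotprod u (q - x).
    under eq_bigr do rewrite dotprodBr mulrBr.
    rewrite sumrB -mulr_suml c0 mul0r subr0.
    under eq_bigr do rewrite -dotprodZr.
    rewrite -dotprod_sumr -c1 /dotprod (bigD1 i)//= !mxE !eqxx mulr1 big1 ?addr0//.
    by move=> j ji; rewrite mxE (negbTE ji) andbF mulr0.
  rewrite mulr_suml; apply: le_trans (ler_norm_sum _ _ _) _.
  by rewrite !big_seq; apply: ler_sum => q qT; rewrite normrM ler_wpM2l// abs_M.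
rewrite -[X in X <= _](mulfVK (lt0r_neq0 K0)) -/M leNgt => /negP; apply.
have -> : M * K = M + C * (d.+1%:R * M) by rewrite /K; ring.
by rewrite ltrDr.
Qed.

End CentrePoint.

Section GenericCentre.
Import fintype mathcomp.boot.finset.
Local Open Scope ring_scope.
Variables (R : realType) (d : nat).
Implicit Types (u x : 'rV[R]_d) (S : {fset 'rV[R]_d}).

Lemma card_bigcup_le (I T : finType) (B : {set I}) (F : I -> {set T}) m :
  (forall i, i \in B -> (#|F i| <= m)%N) -> (#|\bigcup_(i in B) F i| <= #|B| * m)%N.
Proof.
move=> Fm; rewrite -sum_nat_const.
elim/big_ind2 : _ => [|X a Y b Xa Yb|i /Fm//]; first by rewrite cards0.
by apply: leq_trans (leq_add Xa Yb); rewrite cardsU leq_subr.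
Qed.

(** Helly's theorem for the interiors of the hulls of all subsets omitting [k] points: at most [d+1]
    of them together miss at most [(d+1) k] points, hence share the vertices of a simplex. *)
Lemma exists_deep_point S k : general_position S -> (k.+1 * d.+1 <= #|` S|)%N ->
  exists x, exists2 e : R, 0 < e & forall (Q : {set S}) u, (#|Q| + k = #|` S|)%N ->
    exists2 q, q \in Q & e * norm1 u <= dotprod u (val q - x).
Proof.
move=> gS kS.
have cS : #|{: S}| = #|` S| by rewrite -cardfE.
pose A := [set Q : {set S} | (#|Q| + k)%N == #|` S|].
pose K (Q : {set S}) := interior_hull (val : S -> 'rV[R]_d) (fun q => q \in Q).
have [||x xK] := @helly R d _ K A.
- by move=> Q; apply: interior_hull_convex.
- move=> B BA Bd.
  pose I := \bigcap_(Q in B) Q.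
  have cI : (#|~: I| <= #|B| * k)%N.
    rewrite setC_bigcap; apply: card_bigcup_le => Q QB.
    have := subsetP BA Q QB; rewrite inE => /eqP; have := cardsC Q; rewrite cS; lia.
  have dI : (d.+1 <= #|I|)%N.
    have := cardsC I; rewrite cS; have := leq_mul2r k #|B| d.+1; rewrite Bd orbT; lia.
  have [W] : exists W : {set S}, W \in [set W : {set S} | W \subset I & #|W| == d.+1].
    by apply/set0Pn; rewrite -card_gt0 cards_draws bin_gt0.
  rewrite inE => /andP[/subsetP WI /eqP cW].
  pose T := [fset val q | q in W]%fset.
  have cT : #|` T| = d.+1 by rewrite card_imfset /=; [rewrite -cardE|exact: val_inj].
  have indT : affinely_independent T.
    apply: gS; last by rewrite cT.
    by apply/fsubsetP => _ /imfsetP[q _ ->]; exact: valP.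
  have [x [e e0 xe]] := interior_simplex indT cT.
  exists x => Q QB; exists e => // u.
  have [_ /imfsetP[q /= qW ->] qx] := xe u; exists q => //.
  by have /bigcapP := WI q qW; apply.
have /choice[e eP] : forall Q : {set S}, exists e : R, 0 < e /\ (Q \in A ->
    forall u, exists2 q, q \in Q & e * norm1 u <= dotprod u (val q - x)).
  move=> Q; have [/xK[e e0 H]|_] := boolP (Q \in A); first by exists e.
  by exists 1; rewrite ltr01.
(* The least of the finitely many margins serves every [Q]. *)
have [Q0 _ Qmin] := @arg_minP _ _ _ set0 xpredT e isT.
exists x, (e Q0); first by have [] := eP Q0.
move=> Q u cQ; have [_ ] := eP Q; rewrite inE cQ eqxx => /(_ isT u)[q qQ qx].
by exists q => //; apply: le_trans qx; rewrite ler_wpM2r ?norm1_ge0// Qmin.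
Qed.

(** A coordinatewise shift below [e / 2] costs at most half of the margin. If at most [k] points
    were on the positive side, the others would contain a [Q] violating what remains of it. *)
Lemma exists_generic_centre S k : (0 < d)%N -> general_position S ->
  (k.+1 * d.+1 <= #|` S|)%N ->
  exists x, [/\ x \notin S, general_position (x |` S)%fset &
    forall u, u != 0 -> (k < #|[set q : S | (0 < dotprod u (val q - x))%R]|)%N].
Proof.
move=> d0 gS kS; have [x0 [e e0 x0P]] := exists_deep_point gS kS.
have e20 : 0 < e / 2 by rewrite divr_gt0.
have [x [xS xe gxS]] := general_positionU1_near x0 d0 e20 gS.
exists x; split=> // u u0; rewrite ltnNge; apply/negP => le_k.
set Q0 := [set q : S | _] in le_k.
have cS : #|{: S}| = #|` S| by rewrite -cardfE.
have kn : (k <= #|` S|)%N by apply: leq_trans kS; nia.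
have cQ0 : (#|` S| - k <= #|~: Q0|)%N by have := cardsC Q0; rewrite cS; lia.
have [Q] : exists Q : {set S}, Q \in [set W : {set S} | W \subset ~: Q0 & #|W| == (#|` S| - k)%N].
  by apply/set0Pn; rewrite -card_gt0 cards_draws bin_gt0.
rewrite inE => /andP[/subsetP QQ0 /eqP cQ].
have [|q /QQ0] := x0P Q u; first by rewrite cQ subnK.
rewrite !inE -leNgt !dotprodBr => qx qx0.
have : `|dotprod u (x - x0)| <= e / 2 * norm1 u.
  by apply: dotprod_le_norm1 => i; have := xe i; rewrite !mxE => /ltW.
rewrite dotprodBr ler_norml => /andP[_].
have := norm1_gt0 u0; have : 0 < e / 2 * norm1 u by rewrite mulr_gt0// norm1_gt0.
have e2 : e * norm1 u = 2 * (e / 2 * norm1 u) by field.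
lra.
Qed.

End GenericCentre.

(** * The lower bound *)

Section LowerBound.
Import fintype mathcomp.boot.finset.
Local Open Scope ring_scope.
Variables (R : realType) (d : nat).
Implicit Types (u x : 'rV[R]_d) (S : {fset 'rV[R]_d}).

Lemma card_fset_val S (B : {set S}) : #|` [fset val q | q in B]%fset| = #|B|.
Proof. by rewrite card_imfset /=; [rewrite -cardE|exact: val_inj]. Qed.

Lemma leq_sum_card_fsets (I : finType) (X : choiceType) (A : {set I}) (lev : I -> nat) k
    (f : I -> X) (F : nat -> {fset X}) :
  {in A &, injective f} -> (forall i, i \in A -> (lev i <= k)%N) ->
  (forall i, i \in A -> f i \in F (lev i)) ->
  (#|A| <= \sum_(j < k.+1) #|` F j|)%N.
Proof.
move=> finj levk fF; rewrite -sum1_card.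
rewrite (partition_big (fun i => inord (lev i) : 'I_k.+1) xpredT)//=.
apply: leq_sum => j _.
rewrite (eq_bigl (mem [set i in A | lev i == j])); last first.
  move=> i; rewrite !inE; have [iA|//] := boolP (i \in A).
  by rewrite -val_eqE /= inordK// ltnS levk.
rewrite sum1_card cardE -(size_map f).
apply: (@uniq_leq_size _ _ (F j)).
  rewrite map_inj_in_uniq ?enum_uniq// => x y; rewrite !mem_enum !inE.
  by move=> /andP[xA _] /andP[yA _]; exact: finj.
move=> _ /mapP[i + ->]; rewrite mem_enum inE => /andP[iA /eqP <-].
exact: fF.
Qed.

Lemma num_lekfacets_ge S k : (0 < d)%N -> general_position S ->
  (k.+1 * d.+1 <= #|` S|)%N -> (d.+1 * 'C(k + d, d) <= num_lekfacets S k)%N.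
Proof.
move=> d0 gS kS; have [O [OS gOS deepO]] := exists_generic_centre d0 gS kS.
(* Polarity centred at [O]: [x] stands for the hyperplane [x . y = 1 + x . O], which has [O] on its
   negative side; [q] is tight or above at [x] when it lies on this hyperplane or on its positive
   side. *)
pose a (q : S) := val q - O.
have aE q x b : (dotprod (a q) x == b) = (dotprod x (val q) == b + dotprod x O).
  by rewrite dotprodC dotprodBr subr_eq.
have valS (B : {set S}) : ([fset val q | q in B] `<=` S)%fset.
  by apply/fsubsetP => _ /imfsetP[q _ ->]; exact: valP.
have simple : simple_arrangement a (fun=> 1) setT.
  split=> [u u0|x].
    set t := tight _ _ _ _.
    (* The points tight in direction [u] share a hyperplane with [O]; counting [O] as well makes the
       bound strict. *)
    have Ot : O \notin [fset val q | q in t]%fset.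
      by apply: contra OS => /imfsetP[q _ ->]; exact: valP.
    have <- : #|` (O |` [fset val q | q in t])%fset| = #|t|.+1.
      by rewrite cardfsU1 Ot card_fset_val.
    apply: (general_position_on_hyperplane gOS _ u0 (b := dotprod u O)).
      by apply: fsetUS; exact: valS.
    move=> y; rewrite in_fset1U => /orP[/eqP ->//|/imfsetP[q /=]].
    by rewrite inE aE add0r => /andP[_ /eqP qu] ->.
  have [->|x0] := eqVneq x 0.
    rewrite (_ : tight _ _ _ _ = set0) ?cards0//; apply/setP => q.
    by rewrite !inE dotprod0r eq_sym oner_eq0.
  rewrite -card_fset_val; apply: (general_position_on_hyperplane gS (valS _) x0 (b := 1 + dotprod x O)).
  by move=> y /imfsetP[q /=]; rewrite inE aE => /andP[_ /eqP qx] ->.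
have deep : deep a setT k.
  move=> u /deepO; rewrite (_ : above _ _ _ _ = [set q : S | 0 < dotprod u (val q - O)])//.
  by apply/setP => q; rewrite !inE dotprodC.
have strict q : q \in setT -> dotprod (a q) 0 < (1 : R) by rewrite dotprod0r ltr01.
apply: leq_trans (card_lek_vertices simple deep strict) _.
pose xv (B : {set S}) := xget 0 (fun x => (forall q, q \in B -> dotprod (a q) x = 1) /\
  (#|above a (fun=> 1%R) setT x| <= k)%N).
have xvP B : B \in lek_vertices a (fun=> 1) setT k -> #|B| = d /\
    (forall q, q \in B -> dotprod (a q) (xv B) = 1) /\
    (#|above a (fun=> 1%R) setT (xv B)| <= k)%N.
  rewrite inE => /and3P[_ /eqP cB /asboolP[x xB xk]]; split => //.
  by apply: (@xgetPex _ 0 (fun x => (forall q, q \in B -> dotprod (a q) x = 1) /\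
    (#|above a (fun=> 1%R) setT x| <= k)%N)); exists x.
apply: (@leq_sum_card_fsets _ _ _ (fun B : {set S} => #|above a (fun=> 1%R) setT (xv B)|) k
  (fun B : {set S} => ([fset val q | q in B]%fset, [set y | 1 + dotprod (xv B) O < dotprod (xv B) y]%classic))
  (fun j => fset_set (jfacet S j))).
- move=> B B' _ _ [] /fsetP e _; apply/setP => q; have := e (val q).
  by rewrite !(mem_imfset _ _ val_inj).
- by move=> B /xvP[_ []].
move=> B /xvP[cB [xB _]]; rewrite in_fset_set; last exact: finite_jfacet.
apply: classical_sets.mem_set; split=> /=.
- exact: valS.
- by rewrite card_fset_val.
- have x0 : xv B != 0.
    have [q qB] : exists q, q \in B by apply/set0Pn; rewrite -card_gt0 cB.
    by apply: contra_eq_neq (xB q qB) => ->; rewrite dotprod0r eq_sym oner_eq0.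
  exists (xv B), (1 + dotprod (xv B) O); split=> //.
  apply: (affine_span_hyperplane gS (valS _)) => //; first by rewrite card_fset_val.
  by move=> y /imfsetP[q /= qB ->]; apply/eqP; rewrite -aE xB.
rewrite -card_fset_val; congr #|` _|; apply/fsetP => y; rewrite in_fsetE !inE /=.
apply/andP/imfsetP => [[yS]|[q /=]].
  move=> /classical_sets.set_mem /= yx; exists [` yS]%fset => //=.
  by rewrite !inE dotprodC dotprodBr ltrBrDr.
rewrite !inE /= => qx ->; split; first exact: valP.
by apply: classical_sets.mem_set => /=; move: qx; rewrite dotprodC dotprodBr ltrBrDr.
Qed.

End LowerBound.

(** * Extremal sets *)

Section Counting.
Import fintype mathcomp.boot.finset.

(** For facets, [h] forgets the orientation and [g] decodes. Since [h f] determines [f] and its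
    level, distinct facets receive distinct codes, and [J] recovers the level from the code. *)
Lemma leq_sum_card_codes (I : finType) (X : choiceType) (Y : Type) (c0 : I) (C : {set I})
    (F : nat -> {fset X}) (h : X -> Y) (g : I -> Y) k :
  (forall j f, j <= k -> f \in F j -> exists2 c, c \in C & h f = g c)%N ->
  (forall j j' f f', j <= k -> j' <= k -> f \in F j -> f' \in F j' ->
    h f = h f' -> f = f' /\ j = j')%N ->
  (\sum_(j < k.+1) #|` F j| <= #|C|)%N.
Proof.
move=> FC hinj.
pose J c : 'I_k.+1 := odflt ord0 [pick j : 'I_k.+1 | `[< exists2 f, f \in F j & h f = g c >]].
rewrite -sum1_card (partition_big J xpredT)//=; apply: leq_sum => j _.
have jk : (j <= k)%N by rewrite -ltnS.
have /choice[c cP] : forall f, exists c, f \in F j -> c \in C /\ h f = g c.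
  move=> f; have [fF|_] := boolP (f \in F j); last by exists c0.
  by have [c cC hc] := FC j f jk fF; exists c.
rewrite (eq_bigl (mem [set c in C | J c == j])); last by move=> i; rewrite !inE.
rewrite sum1_card cardE -(size_map c); apply: uniq_leq_size.
  rewrite map_inj_in_uniq ?fset_uniq// => f f' /[dup] fF /cP[_ e] /[dup] f'F /cP[_ e'] ec.
  by have [] := hinj j j f f' jk jk fF f'F; rewrite // e e' ec.
move=> _ /mapP[f fF ->]; have [cC e] := cP f fF.
rewrite mem_enum inE cC /= /J; case: pickP => [i /asboolP[f' f'F e']|/(_ j)] /=; last first.
  by move=> /asboolP; case; exists f.
apply/eqP/val_inj.
have ik : (i <= k)%N by rewrite -ltnS.
by have [] := hinj i j f' f ik jk f'F fF; rewrite // e' e.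
Qed.

End Counting.

Section Construction.
Local Open Scope fset_scope.
Local Open Scope ring_scope.
Variables (R : realType) (d n : nat).
Hypothesis d_gt0 : (0 < d)%N.
Implicit Types (u w x y : 'rV[R]_d).

Lemma general_position_near (tgt : nat -> 'rV[R]_d) (e : R) m : 0 < e ->
  exists s : seq 'rV[R]_d, [/\ size s = m, uniq s, general_position [fset x in s] &
    forall i, (i < m)%N -> forall j, `|(nth 0 s i - tgt i) 0 j| < e].
Proof.
move=> e0; elim: m => [|m [s [sm us gs cs]]].
  exists [::]; split=> // T; rewrite (_ : [fset x in [::]] = fset0) ?fsubset0; last first.
    by apply/fsetP => x; rewrite !inE.
  by move=> /eqP -> _ c _ _ x; rewrite inE.
have [x [xs xe gx]] := general_positionU1_near (tgt m) d_gt0 e0 gs.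
exists (rcons s x); split=> [|||i im j].
- by rewrite size_rcons sm.
- by rewrite rcons_uniq us andbT; move: xs; rewrite inE.
- rewrite (_ : [fset y in rcons s x] = x |` [fset y in s])//.
  by apply/fsetP => y; rewrite !inE mem_rcons inE.
rewrite nth_rcons sm; move: im; rewrite ltnS leq_eqVlt => /orP[/eqP ->|im].
  by rewrite ltnn eqxx !mxE; have := xe j.
by rewrite im; exact: cs.
Qed.

(* The vertices of a simplex containing the origin in its interior. *)
Definition ray (i : nat) : 'rV[R]_d :=
  \row_j if i is i'.+1 then (j == i' :> nat)%:R else -1.

(** A lower bound for the support function of the simplex spanned by the [ray i]. *)
Definition width u : R := norm1 u / (2 * d.+1%:R).

Lemma width_gt0 u : u != 0 -> 0 < width u.
Proof. by move=> u0; rewrite divr_gt0 ?norm1_gt0// mulr_gt0 ?ltr0n. Qed.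

(** If every ray stayed below [w = width u], then [|u_j| <= 2 w - u_j] for all [j] and
    [- sum u_j < w], whence [norm1 u < (2 d + 1) w]. *)
Lemma exists_ray_ge_width u : u != 0 -> exists2 i, (i < d.+1)%N & width u <= dotprod u (ray i).
Proof.
move=> u0; apply: contrapT => H.
have lt_w i : (i < d.+1)%N -> dotprod u (ray i) < width u.
  by move=> id; rewrite ltNge; apply/negP => h; apply: H; exists i.
have r0 : dotprod u (ray 0) = - \sum_j u 0 j.
  by rewrite /dotprod -sumrN; apply: eq_bigr => j _; rewrite mxE mulrN1.
have rS (j : 'I_d) : dotprod u (ray j.+1) = u 0 j.
  rewrite /dotprod (bigD1 j)//= mxE eqxx mulr1 big1 ?addr0// => i ij.
  by rewrite mxE (inj_eq val_inj) (negbTE ij) mulr0.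
have w0 := width_gt0 u0.
have : norm1 u <= \sum_(j < d) (2 * width u - u 0 j).
  apply: ler_sum => j _; rewrite -rS; have := lt_w j.+1; rewrite ltnS => /(_ (ltn_ord j)).
  by case: (ger0P (dotprod u _)); lra.
rewrite sumrB sumr_const card_ord -mulr_natr; have := lt_w 0%N isT; rewrite r0.
have : norm1 u = width u * (2 * d.+1%:R).
  by rewrite /width mulfVK// mulf_neq0 ?pnatr_eq0.
by rewrite -natr1; lra.
Qed.

(** Chosen so that [1 - 2 eta = (2 n + 1) eta], as [ray_dot_gt] requires. *)
Let eta : R := (2 * n%:R + 3)^-1.

(** Index [m] encodes the ray [m %% d.+1] and the rank [m %/ d.+1] on it, rank 0 being outermost. *)
Let dist (m : nat) : R := (n - m %/ d.+1)%:R.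

Variable s : seq 'rV[R]_d.
Hypothesis size_s : size s = n.
Hypothesis uniq_s : uniq s.
Hypothesis gp_s : general_position [fset x in s].
Let S := [fset x in s].
Let P m := nth 0 s m.
Hypothesis close : forall m u, (m < n)%N ->
  `|dotprod u (P m - dist m *: ray (m %% d.+1))| <= eta * width u.

Variable k : nat.
Hypothesis kn : (k.+1 * d.+1 <= n)%N.

Let P_in m : (m < n)%N -> P m \in S.
Proof. by move=> mn; rewrite inE mem_nth// size_s. Qed.

Let P_inj m m' : (m < n)%N -> (m' < n)%N -> P m = P m' -> m = m'.
Proof. by move=> mn mn' /eqP; rewrite nth_uniq ?size_s// => /eqP. Qed.

Let dist_ge1 m : (m < n)%N -> 1 <= dist m.
Proof.
move=> mn; rewrite ler1n subn_gt0; apply: leq_ltn_trans mn; exact: leq_div.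
Qed.

Let dist_le m : dist m <= n%:R.
Proof. by rewrite ler_nat leq_subr. Qed.

Let eta_gt0 : 0 < eta. Proof. by rewrite invr_gt0; have := ler0n R n; lra. Qed.

Let etaE : eta * (2 * n%:R + 3) = 1.
Proof. by rewrite mulVf// gt_eqF//; have := ler0n R n; lra. Qed.

Let dot_lower m u : (m < n)%N ->
  dist m * dotprod u (ray (m %% d.+1)) - eta * width u <= dotprod u (P m).
Proof. by move=> mn; have := close u mn; rewrite dotprodBr dotprodZr ler_norml; lra. Qed.

Let dot_upper m u : (m < n)%N ->
  dotprod u (P m) <= dist m * dotprod u (ray (m %% d.+1)) + eta * width u.
Proof. by move=> mn; have := close u mn; rewrite dotprodBr dotprodZr ler_norml; lra. Qed.

Let size_index_le (H : {fset 'rV[R]_d}) (t : seq nat) :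
  uniq t -> (forall m, m \in t -> (m < n)%N && (P m \in H)) -> (size t <= #|` H|)%N.
Proof.
move=> ut tH; rewrite -(size_map P); apply: uniq_leq_size.
  rewrite map_inj_in_uniq// => m m' /tH/andP[mn _] /tH/andP[mn' _]; exact: P_inj.
by move=> _ /mapP[m /tH/andP[_ mH] ->].
Qed.

Section Halfspace.
Variables (u : 'rV[R]_d) (b : R).
Hypothesis u0 : u != 0.
Let H := [fset y in S | b < dotprod u y].
Hypothesis cardH : (#|` H| <= k)%N.

Let index_lt r i : (r <= k)%N -> (i < d.+1)%N -> (r * d.+1 + i < n)%N.
Proof. by move=> rk id; apply: leq_trans kn; nia. Qed.

(** Otherwise the [k+1] outermost points of a ray reaching [width u] would all lie in [H]. *)
Lemma halfspace_offset : (1 - eta) * width u <= b.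
Proof.
rewrite leNgt; apply/negP => bw.
have [i id iw] := exists_ray_ge_width u0.
have w0 := width_gt0 u0.
suff : (k.+1 <= #|` H|)%N by rewrite ltnNge cardH.
rewrite -(size_iota 0 k.+1) -(size_map (fun r => r * d.+1 + i)%N); apply: size_index_le.
  by rewrite map_inj_uniq ?iota_uniq// => r r' /eqP; rewrite eqn_add2r eqn_mul2r => /eqP.
move=> _ /mapP[r + ->]; rewrite mem_iota /= add0n ltnS => rk.
have mn := index_lt rk id; rewrite mn /= !inE -/S.
have := P_in mn; rewrite !inE => -> /=; apply: lt_le_trans (dot_lower u mn).
rewrite modnMDl modn_small//; apply: (lt_le_trans bw).
have := dist_ge1 mn; set D := dist _ => D1.
have : 0 <= (D - 1) * dotprod u (ray i) by rewrite mulr_ge0//; lra.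
by nra.
Qed.

Lemma halfspace_offset_gt0 : 0 < b.
Proof.
apply: lt_le_trans halfspace_offset; rewrite mulr_gt0 ?width_gt0// subr_gt0.
have := etaE; have := eta_gt0; have := ler0n R n; nra.
Qed.

(** The offset bound gives [dist m * X >= (1 - 2 eta) W = (2 n + 1) eta W] for the product [X] with
    the ray, and [dist m <= n]. The threshold is the total perturbation of two points. *)
Lemma ray_dot_gt m : (m < n)%N -> dotprod u (P m) = b ->
  2 * eta * width u < dotprod u (ray (m %% d.+1)).
Proof.
move=> mn mb; have := dot_upper u mn; rewrite mb.
have := halfspace_offset; have w0 := width_gt0 u0.
have := dist_ge1 mn; have := dist_le m.
set D := dist m; set X := dotprod _ _; set W := width u in w0 *; move=> Dn D1 bW bD.
have E : (2 * n%:R + 1) * (eta * W) = (1 - 2 * eta) * W.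
  have -> : (2 * n%:R + 1) * (eta * W) = (eta * (2 * n%:R + 3) - 2 * eta) * W by ring.
  by rewrite etaE.
have DX : (2 * n%:R + 1) * (eta * W) <= D * X by rewrite E; lra.
have eW : 0 < eta * W by rewrite mulr_gt0.
have n0 := ler0n R n.
have X0 : 0 < X by rewrite -(@pmulr_rgt0 _ D)//; [nra|lra].
have nX : D * X <= n%:R * X by rewrite ler_pM2r.
have n1 : 0 < n%:R :> R by lra.
by rewrite -(ltr_pM2l n1); nra.
Qed.

(** One step outwards on the ray gains more than both perturbations can cancel. *)
Lemma outer_in_halfspace m m' : (m < n)%N -> (m' < m)%N -> m = m' %[mod d.+1] ->
  dotprod u (P m) = b -> b < dotprod u (P m').
Proof.
move=> mn mm' e mb; have mn' := ltn_trans mm' mn.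
apply: lt_le_trans (dot_lower u mn'); rewrite -e.
have := ray_dot_gt mn mb; have := dot_upper u mn; rewrite mb.
have w0 := width_gt0 u0; have eW : 0 < eta * width u by rewrite mulr_gt0.
have : dist m + 1 <= dist m'.
  rewrite /dist natr1 ler_nat.
  have rr : (m' %/ d.+1 < m %/ d.+1)%N.
    by have := divn_eq m d.+1; have := divn_eq m' d.+1; rewrite e; nia.
  have := leq_div m d.+1; lia.
set X := dotprod _ _ => D1 mU X2.
have : 0 <= (dist m' - (dist m + 1)) * X by rewrite mulr_ge0//; lra.
nra.
Qed.

End Halfspace.
Let facetE j f : (j <= k)%N -> jfacet S j f ->
  exists u b, [/\ u != 0, affine_span f.1 = [set y | dotprod u y = b]%classic,
    f.2 = [set y | b < dotprod u y]%classic,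
    #|` [fset y in S | b < dotprod u y]| = j & (#|` [fset y in S | (b < dotprod u y)%R]| <= k)%N].
Proof.
move=> jk [_ _ [u [b [u0 spanE HE]]] Hj]; exists u, b.
have Ej : #|` [fset y in S | b < dotprod u y]| = j.
  rewrite -Hj; congr #|` _|; apply/fsetP => y; rewrite !inE /=; congr andb.
  by rewrite HE; apply/idP/idP => [?|]; [apply: mem_set|move=> /set_mem].
by split=> //; rewrite Ej.
Qed.

(** Both negative sides contain the origin, because the offsets are positive; half-spaces with the
    same boundary and a common point coincide. *)
Lemma jfacet_uniq j j' f f' : (j <= k)%N -> (j' <= k)%N ->
  jfacet S j f -> jfacet S j' f' -> f.1 = f'.1 -> f = f' /\ j = j'.
Proof.
move=> jk j'k fj f'j'; case: f f' => [B H] [B' H'] in fj f'j' * => /= BB'.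
rewrite -{B'}BB' in f'j' *.
suff HH' : H = H'.
  rewrite -{H'}HH' in f'j' *; split=> //.
  by case: fj => _ _ _ <-; case: f'j' => _ _ _ <-.
have [u [b [u0 spanE /= HE Ej cH]]] := facetE jk fj.
have [u' [b' [u0' spanE' /= HE' Ej' cH']]] := facetE j'k f'j'.
have b0 := halfspace_offset_gt0 u0 cH; have b0' := halfspace_offset_gt0 u0' cH'.
rewrite /= in spanE spanE'.
have opp v c : v != 0 -> affine_span B = [set y | dotprod v y = c]%classic ->
    open_halfspace_bounded_by (affine_span B) [set y | dotprod v y < c]%classic.
  move=> v0 vE; exists (- v), (- c); rewrite oppr_eq0; split=> //.
    by rewrite vE; apply/seteqP; split=> y /=; rewrite dotprodNl; [move=> ->|exact: oppr_inj].
  by apply/seteqP; split=> y /=; rewrite dotprodNl ltrN2.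
have [o o'] := (opp u b u0 spanE, opp u' b' u0' spanE').
have N : [set y | dotprod u y < b]%classic = [set y | dotprod u' y < b']%classic.
  apply/seteqP; split.
    by apply: (@open_halfspace_sub _ _ _ _ _ 0 o o'); rewrite /= dotprod0r.
  by apply: (@open_halfspace_sub _ _ _ _ _ 0 o' o); rewrite /= dotprod0r.
have EN y : (dotprod u y < b) = (dotprod u' y < b').
  by apply/idP/idP => h; [have : [set y | dotprod u y < b]%classic y by []; rewrite N
    |have : [set y | dotprod u' y < b']%classic y by []; rewrite -N].
have EH y : (dotprod u y == b) = (dotprod u' y == b').
  have : affine_span B y <-> affine_span B y by [].
  by rewrite {1}spanE spanE' /= => -[h h']; apply/eqP/eqP.
rewrite HE HE'; apply/seteqP; split=> y /=; rewrite !ltNge !le_eqVlt EN EH//.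
Qed.

(** [c.1] is the ray without a vertex, and [c.2] lists the ranks on the [d] other rays. *)
Definition code_vertices (c : 'I_d.+1 * d.-tuple 'I_k.+1) : {fset 'rV[R]_d} :=
  [fset P (tnth c.2 j * d.+1 + lift c.1 j) | j in 'I_d].

Lemma jfacet_code j f : (j <= k)%N -> jfacet S j f ->
  exists2 c : 'I_d.+1 * d.-tuple 'I_k.+1, (\sum_(i <- c.2) i <= k)%N & f.1 = code_vertices c.
Proof.
move=> jk fj; have [u [b [u0 spanE HE Ej cH]]] := facetE jk fj.
case: fj => BS cB _ _.
set B := f.1 in BS cB spanE *.
pose MB := [seq m <- iota 0 n | P m \in B].
have MBP m : m \in MB -> [/\ (m < n)%N, P m \in B & dotprod u (P m) = b].
  rewrite mem_filter mem_iota /= => /andP[mB mn]; split=> //.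
  by have := sub_affine_span mB; rewrite spanE.
have size_MB : size MB = d.
  rewrite -cB -(size_map P); apply/perm_size/uniq_perm.
  - rewrite map_inj_in_uniq ?filter_uniq ?iota_uniq// => m m' /MBP[mn _ _] /MBP[mn' _ _].
    exact: P_inj.
  - exact: fset_uniq.
  move=> y; apply/mapP/idP => [[m /MBP[_ mB _] ->]//|yB].
  have := fsubsetP BS y yB; rewrite inE => /(nthP 0)[m]; rewrite size_s => mn my.
  by exists m => //; rewrite mem_filter mem_iota /P my yB.
(* Of two vertices on one ray, the outer would lie strictly on the positive side. *)
have mod_inj : {in MB &, injective (fun m => m %% d.+1)%N}.
  move=> m m' /MBP[mn _ mb] /MBP[mn' _ mb'] e; case: (ltngtP m m') => // mm'.
    by have := outer_in_halfspace u0 cH mn' mm' (esym e) mb'; rewrite mb ltxx.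
  by have := outer_in_halfspace u0 cH mn mm' e mb; rewrite mb' ltxx.
pose rs := [seq (m %% d.+1)%N | m <- MB].
have uniq_rs : uniq rs by rewrite map_inj_in_uniq ?filter_uniq ?iota_uniq.
have rs_lt i : i \in rs -> (i < d.+1)%N by move=> /mapP[m _ ->]; rewrite ltn_mod.
have [i0 i0rs] : exists i0 : 'I_d.+1, val i0 \notin rs.
  apply: contrapT => H.
  suff : (size (iota 0 d.+1) <= size rs)%N by rewrite size_iota size_map size_MB ltnn.
  apply: uniq_leq_size; first exact: iota_uniq.
  move=> i; rewrite mem_iota /= => id; apply/negPn/negP => irs.
  by apply: H; exists (Ordinal id).
have rs_lift (i : 'I_d) : val (lift i0 i) \in rs.
  apply/negPn/negP => irs.
  suff : (size [:: val i0, val (lift i0 i) & rs] <= size (iota 0 d.+1))%N.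
    by rewrite size_iota /= size_map size_MB ltnn.
  apply: uniq_leq_size; first by rewrite /= inE negb_or irs i0rs uniq_rs neq_bump.
  by move=> i'; rewrite mem_iota add0n !in_cons => /or3P[/eqP ->|/eqP ->|/rs_lt//]; exact: ltn_ord.
have /choice[M MP] : forall i : 'I_d, exists m, m \in MB /\ (m %% d.+1)%N = lift i0 i.
  by move=> i; have /mapP[m mMB e] := rs_lift i; exists m.
pose rk i := (M i %/ d.+1)%N.
have ME i : M i = (rk i * d.+1 + lift i0 i)%N.
  by have [_ <-] := MP i; rewrite -divn_eq.
have sum_rk : (\sum_(i < d) rk i <= k)%N.
  apply: (leq_trans _ cH).
  (* The points further out than a vertex on its ray: distinct, and all on the positive side. *)
  pose L := [seq (r * d.+1 + lift i0 i)%N | i <- enum 'I_d, r <- iota 0 (rk i)].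
  have -> : (\sum_(i < d) rk i)%N = size L.
    rewrite size_allpairs_dep sumnE big_map big_enum /=.
    by apply: eq_bigr => i _; rewrite size_iota.
  apply: size_index_le.
    apply: allpairs_uniq_dep; first exact: enum_uniq.
      by move=> i _; exact: iota_uniq.
    move=> [i r] [i' r'] _ _ /= e.
    have ii' : i = i'.
      apply: (@lift_inj _ i0); apply/val_inj.
      have e2 : (r * d.+1 + lift i0 i = r' * d.+1 + lift i0 i' %[mod d.+1])%N.
        by congr (_ %% _)%N.
      by move: e2; rewrite !modnMDl !modn_small// ltn_ord.
    rewrite -ii' in e *; congr existT; apply/eqP.
    by move/eqP: e; rewrite eqn_add2r eqn_mul2r.
  move=> _ /allpairsPdep[i [r [_ + ->]]]; rewrite mem_iota /= add0n => rrk.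
  have [iMB imod] := MP i; have [mn _ mb] := MBP _ iMB.
  have lt_M : (r * d.+1 + lift i0 i < M i)%N by rewrite ME ltn_add2r ltn_mul2r rrk.
  have e : M i = (r * d.+1 + lift i0 i)%N %[mod d.+1].
    by rewrite imod modnMDl modn_small.
  rewrite (ltn_trans lt_M mn) /= !inE (outer_in_halfspace u0 cH mn lt_M e mb) andbT.
  by have := P_in (ltn_trans lt_M mn); rewrite inE.
have rk_le i : (rk i <= k)%N.
  by apply: leq_trans sum_rk; rewrite (bigD1 i)//= leq_addr.
exists (i0, [tuple inord (rk i) | i < d]).
  rewrite big_tuple; apply: leq_trans sum_rk; apply: leq_sum => i _.
  by rewrite tnth_mktuple inordK ?ltnS.
have code i : P (tnth [tuple inord (rk i) : 'I_k.+1 | i < d] i * d.+1 + lift i0 i) = P (M i).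
  by rewrite tnth_mktuple inordK ?ltnS// -ME.
apply/esym/eqP; rewrite eqEfcard; apply/andP; split.
  apply/fsubsetP => _ /imfsetP[i _ ->] /=; rewrite code.
  by have [/MBP[_ ? _] _] := MP i.
rewrite cB card_imfset /=; first by rewrite -cardE card_ord.
move=> i i'; rewrite !code; have [/MBP[mn _ _] e] := MP i; have [/MBP[mn' _ _] e'] := MP i'.
move=> /(P_inj mn mn') ii'; apply: (@lift_inj _ i0); apply/val_inj.
by have := e; rewrite ii' e' => /esym.
Qed.

Lemma num_lekfacets_le : (num_lekfacets S k <= d.+1 * 'C(k + d, d))%N.
Proof.
pose C := [set c : 'I_d.+1 * d.-tuple 'I_k.+1 | \sum_(i <- c.2) i <= k]%SET%N.
have <- : #|C| = (d.+1 * 'C(k + d, d))%N.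
  rewrite addnC -card_partial_ord_partitions -[X in (X * _)%N](card_ord d.+1).
  rewrite -finset.cardsT -finset.cardsX.
  by apply: eq_card => c; rewrite !inE.
apply: (@leq_sum_card_codes _ _ _ (ord0, [tuple ord0 | _ < d]) C
  (fun j => fset_set (jfacet S j)) fst code_vertices).
- move=> j f jk; rewrite in_fset_set; last exact: finite_jfacet.
  by move=> /set_mem/(jfacet_code jk)[c ck ->]; exists c; rewrite // inE.
- move=> j j' f f' jk j'k; rewrite !in_fset_set; [|exact: finite_jfacet..].
  by move=> /set_mem fj /set_mem fj'; exact: (jfacet_uniq jk j'k).
Qed.

End Construction.

Section UpperBound.
Local Open Scope fset_scope.
Local Open Scope ring_scope.

Lemma exists_num_lekfacets_le (R : realType) d n k : (0 < d)%N -> (k.+1 * d.+1 <= n)%N ->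
  exists S : {fset 'rV[R]_d}, [/\ #|` S| = n, general_position S &
    (num_lekfacets S k <= d.+1 * 'C(k + d, d))%N].
Proof.
move=> d0 kn.
pose eta : R := (2 * n%:R + 3)^-1.
have eta0 : 0 < eta by rewrite invr_gt0; have := ler0n R n; lra.
(* This coordinatewise error becomes [eta * width u] after pairing with [u]. *)
have e0 : 0 < eta / (2 * d.+1%:R) by rewrite divr_gt0// mulr_gt0.
have [s [sn us gs cs]] := general_position_near d0
  (fun m => (n - m %/ d.+1)%:R *: ray R d (m %% d.+1)) n e0.
exists [fset x in s]; split=> //; first by rewrite card_fseq undup_id.
apply: (@num_lekfacets_le _ _ n) => // m u mn.
have -> : eta * width u = eta / (2 * d.+1%:R) * norm1 u.
  by rewrite /width mulrCA mulrC.
by apply: dotprod_le_norm1 => j; apply/ltW/cs.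
Qed.

End UpperBound.

Theorem theorem11 (R : realType) (d n k : nat)
    (hd : (1 <= d)%N) (hn : (d + 1 <= n)%N) (hk : (k < n %/ (d + 1))%N) :
  (forall S : {fset 'rV[R]_d},
     #|` S| = n -> general_position S ->
     ((d + 1) * 'C(k + d, d) <= num_lekfacets S k)%N) /\
  (exists S : {fset 'rV[R]_d},
     [/\ #|` S| = n, general_position S &
         num_lekfacets S k = ((d + 1) * 'C(k + d, d))%N]).
Proof.
have kn : (k.+1 * d.+1 <= n)%N by rewrite -leq_divRL// -(addn1 d).
rewrite addn1; split=> [S Sn gS|]; first by apply: num_lekfacets_ge; rewrite ?Sn.
have [S [Sn gS le_S]] := exists_num_lekfacets_le R hd kn.
exists S; split=> //; apply/eqP; rewrite eqn_leq le_S /=.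
by apply: num_lekfacets_ge; rewrite ?Sn.
Qed.
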